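(* Let $\sigma=(f,g)$ be a normal sequence of homogeneous polynomials in $\kappa[x_0,\ldots,x_3]$ of degrees $d_f+1$ and $d_g+1$. Then: (a) if $\operatorname{indeg}(\mathcal{T}_\sigma)=1$, then $\operatorname{Bour}(\sigma)\in\{0,1,2\}$; (b) if $\operatorname{indeg}(\mathcal{T}_\sigma)=2$, then $\operatorname{Bour}(\sigma)\le5$.
   Context: Let $\kappa$ be an algebraically closed field of characteristic zero, $R=\kappa[x_0,\ldots,x_3]$ and $\mathbb{P}^3=\operatorname{Proj}R$. A sequence $\sigma=(f,g)$ is an algebraically independent pair of homogeneous polynomials in $R$ with $\deg f=d_f+1$, $\deg g=d_g+1$; set $d=d_f+d_g$ and $m_0=d_f^2+d_g^2+d_fd_g$. Its Jacobian matrix (rows the gradients of $f$ and $g$) defines $\nabla\sigma:\mathcal{O}_{\mathbb{P}^3}^{\oplus4}\to\mathcal{O}_{\mathbb{P}^3}(d_f)\oplus\mathcal{O}_{\mathbb{P}^3}(d_g)$. Write $\mathcal{T}_\sigma=\ker(\nabla\sigma)$ (reflexive of rank 2) and $\mathcal{Q}_\sigma=\operatorname{coker}(\nabla\sigma)$. The sequence is normal if $\operatorname{Supp}\mathcal{Q}_\sigma$ has codimension at least 2. For normal $\sigma$, $\chi(\mathcal{Q}_\sigma(t))=m(\sigma)\,t+\text{const}$ defines the integer $m(\sigma)\ge0$. The initial degree is $e=\operatorname{indeg}(\mathcal{T}_\sigma)=\min\{l\in\mathbb{Z}: H^0(\mathcal{T}_\sigma(l))\ne0\}$. A nonzero $\nu\in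 H^0(\mathcal{T}_\sigma(e))$ gives an exact sequence $0\to\mathcal{O}_{\mathbb{P}^3}(-e)\to\mathcal{T}_\sigma\to\mathcal{I}_{B_\nu}(e-d)\to0$ with $B_\nu\subset\mathbb{P}^3$ empty or of pure dimension 1; the Bourbaki degree is $\operatorname{Bour}(\sigma)=\deg(B_\nu)=e(e-d)+m_0-m(\sigma)$, which is independent of the choice of $\nu$. *)

(* Defs.v *)
From HB Require Import structures.
From mathcomp Require Import all_boot all_order all_algebra.
From mathcomp Require Import freeg mpoly.
From Stdlib Require Import ClassicalEpsilon.

Set Implicit Arguments.
Unset Strict Implicit.
Unset Printing Implicit Defensive.

Import Order.TTheory GRing.Theory Num.Theory.

Local Open Scope ring_scope.

(* Coherent sheaves on P^3 = Proj R are handled through graded modules over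
   R = K[x_0, ..., x_3] = {mpoly K[4]}.  The polynomial 0 is homogeneous of every
   degree. *)

Section Sequences.

Variable K : closedFieldType.
Local Notation R := {mpoly K[4]}.

Record sequence := Sequence {
  df : nat;
  dg : nat;
  seq_f : R;
  seq_g : R;
  seq_f_homog : seq_f \is df.+1.-homog;
  seq_g_homog : seq_g \is dg.+1.-homog;
  seq_algind : forall p : {mpoly K[2]},
    p \mPo [tuple seq_f; seq_g] = 0 -> p = 0
}.

(* H^0(P^3, O(l)) = R_l, for l in Z *)
Definition H0_O (l : int) (p : R) : Prop :=
  match l with
  | Posz n => p \is n.-homog
  | Negz _ => p = 0
  end.

Definition jacobian (s : sequence) : 'M[R]_(2, 4) :=
  \matrix_(i < 2, j < 4) mderiv j (if i == 0 then seq_f s else seq_g s).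

(** ** The sheaf T = ker (nabla sigma) *)

(* The graded module of all H^0(T(l)), l in Z.  As H^0 is left exact, it is the
   kernel of the Jacobian matrix on R^4, graded by the degree of the entries. *)
Definition syz (s : sequence) (u : 'cV[R]_4) : Prop := jacobian s *m u = 0.

Definition H0_T (s : sequence) (l : int) (u : 'cV[R]_4) : Prop :=
  syz s u /\ forall i, H0_O l (u i 0).

Definition is_indeg (s : sequence) (e : int) : Prop :=
  (exists2 u, H0_T s e u & u != 0) /\
  (forall l u, H0_T s l u -> u != 0 -> e <= l).

Definition indeg (s : sequence) : int := epsilon (inhabits 0) (is_indeg s).

(** ** The sheaf Q = coker (nabla sigma) and normality *)

(* Scheme-theoretic points of P^3: homogeneous primes not containing the
   irrelevant ideal. *)
Definition is_point (P : {pred R}) : Prop :=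
  [/\ idealr_closed P, prime_idealr_closed P,
      forall p k, p \in P -> pihomog mdeg k p \in P
    & exists i : 'I_4, 'X_i \notin P].

(* The stalk of Q at P is the degree 0 part of the homogeneous localization at
   P of M = coker (R^4 -> R(df) + R(dg)).  It is nonzero iff some fraction
   (a, b) / t, with t homogeneous outside P and (a, b) of the same degree in M,
   is nonzero, i.e. (a, b) is killed in M by no homogeneous v outside P. *)
Definition in_supp_Q (s : sequence) (P : {pred R}) : Prop :=
  exists (k : nat) (t a b : R),
    [/\ t \is k.-homog, t \notin P,
        a \is (k + df s)%N.-homog, b \is (k + dg s)%N.-homog
      & forall (l : nat) (v : R), v \is l.-homog -> v \notin P ->
        ~ exists u : 'cV[R]_4,
            jacobian s *m u
            = v *: (\col_(i < 2) (if i == 0 then a else b))].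

(* codim_ge n P: the irreducible closed subset with generic point P has
   codimension at least n, i.e. there is a chain of n proper specializations
   P_0 ~> P_1 ~> ... ~> P_n = P (equivalently P_0 < P_1 < ... < P_n = P). *)
Fixpoint codim_ge (n : nat) (P : {pred R}) : Prop :=
  match n with
  | 0 => True
  | n'.+1 => exists P' : {pred R},
      [/\ is_point P', {subset P' <= P},
          exists2 p, p \in P & p \notin P'
        & codim_ge n' P']
  end.

(* The codimension of a closed subset is the infimum of the codimensions of the
   irreducible closed subsets it contains; the empty support is allowed. *)
Definition normal_seq (s : sequence) : Prop :=
  forall P : {pred R}, is_point P -> in_supp_Q s P -> codim_ge 2 P.

(** ** Bourbaki degree *)

(* Exactness of
     0 -> O(-e) --nu--> T --phi--> I_B(e - d) -> 0,   d = df + dg,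
   on global sections of all twists, where it loses nothing because
   H^1(P^3, O(l)) = 0 for all l.  Here phi is a graded R-linear map from the module of
   syzygies to R(e - d) with kernel generated by nu.  Its image is then the
   saturated ideal of B.  The values of phi outside the syzygies are
   irrelevant. *)
Definition bourbaki_seq (s : sequence) (e : int) (nu : 'cV[R]_4)
    (phi : 'cV[R]_4 -> R) : Prop :=
  [/\ forall (a : R) (u v : 'cV[R]_4), syz s u -> syz s v ->
        phi (a *: u + v) = a * phi u + phi v,
      forall l u, H0_T s l u -> H0_O (l + e - (df s + dg s)%N%:Z) (phi u)
    & forall u, syz s u -> phi u = 0 <-> exists a : R, u = a *: nu].

Definition bourbaki_ideal (s : sequence) (phi : 'cV[R]_4 -> R) (h : R) : Prop :=
  exists2 u, syz s u & phi u = h.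

(* chi(O_B(t)) = b t + const, for B = Proj (R / I) empty or of dimension 1:
   the Hilbert polynomial, dim_K (R / I)_t for t large.  The space W is I_t
   inside R_t = dhomog 4 K t. *)
Definition curve_degree (I : R -> Prop) (b : int) : Prop :=
  exists (c : int) (t0 : nat), forall t : nat, (t0 <= t)%N ->
    exists W : {vspace dhomog 4 K t},
      (forall p : dhomog 4 K t, p \in W <-> I (mpoly_of_dhomog p)) /\
      (\dim {:dhomog 4 K t})%:Z - (\dim W)%:Z = b * t%:Z + c.

Definition is_bour (s : sequence) (b : int) : Prop :=
  exists (nu : 'cV[R]_4) (phi : 'cV[R]_4 -> R),
    [/\ H0_T s (indeg s) nu, nu != 0, bourbaki_seq s (indeg s) nu phi
      & curve_degree (bourbaki_ideal s phi) b].

(* For normal sequences, such a b exists and does not depend on nu and phi. *)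
Definition bour (s : sequence) : int := epsilon (inhabits 0) (is_bour s).

End Sequences.

(* Main.v *)
Require Import Defs.
From HB Require Import structures.
From mathcomp Require Import all_boot all_order all_algebra.
From mathcomp Require Import zify ring.
From mathcomp Require Import freeg mpoly.
From Stdlib Require Import Classical ClassicalEpsilon.

Set Implicit Arguments.
Unset Strict Implicit.
Unset Printing Implicit Defensive.

Import Order.TTheory GRing.Theory Num.Theory.
Local Open Scope ring_scope.

(** Why the theorem holds: the Bourbaki degree of a normal sequence is at most the
square of the initial degree e, so it is at most 1 when e = 1 and at most 4 when
e = 2.

Let N be the bivector dual to df /\ dg; its coordinates are, up to sign, the 2x2
minors of the Jacobian matrix.  Normality says that no prime divides all of them:
such a prime would be homogeneous, it would generate a point of the support of the
cokernel ([minors_in_supp]), and the zero locus of one polynomial has codimension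
one ([principal_codim]).  A syzygy nu of minimal degree is primitive as well
([minimal_syzygy_primitive]).  For every syzygy u the bivectors u /\ nu and N are
proportional, since both are dual to df /\ dg over the fraction field; as N is
primitive and polynomials have unique factorization, u /\ nu = phi(u) N with phi(u)
a polynomial, and phi is a Bourbaki map ([bourbaki_map_seq]).

The columns N_k of N are syzygies and satisfy N_k /\ nu = nu_k N
([star_wedge]), so phi(N_k) = nu_k: the ideal of B contains the entries of nu.  This
holds, up to a nonzero constant, for every Bourbaki map attached to nu
([syzygy_entries_in_bourbaki_ideal]).  The field being infinite, two combinations p, q
of these entries are coprime ([coprime_pair]), both of degree e, so that B lies
in a complete intersection of degree e^2, and this bounds its degree
([curve_degree_bounds]).

It remains to know that B has a degree at all, that is, that the Hilbert
function of its ideal I is eventually linear.  By passing to leading monomials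
([hilbert_gap_count]) it counts the exponent vectors outside a set closed upwards,
which is eventually a polynomial by induction on the number of variables
([gap_count_poly]); the linear upper bound given by p and q forces its degree to
be at most one ([eventually_linear]).

Unique factorization of multivariate polynomials is proved by iterating Gauss's
lemma ([factorial_poly], [factorial_mpoly]), in the form that every nonzero element
is a unit times a product of prime elements. *)

(** * Factorial domains *)

Section Factorial.
Variable R : idomainType.
Implicit Types (a b c p q : R) (s : seq R).

Definition divides (a b : R) := exists c, b = c * a.

Definition prime_elt p := [/\ p != 0, p \isn't a GRing.unit
  & forall a b, divides p (a * b) -> divides p a \/ divides p b].

(** Existence of a factorization into primes, rather than irreducibles, already
contains uniqueness. *)
Definition factorial_domain := forall a, a != 0 ->
  exists (u : R) (s : seq R), [/\ u \is a GRing.unit,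
    {in s, forall p, prime_elt p} & a = u * \prod_(p <- s) p].

Lemma divides_mull c a b : divides a b -> divides a (c * b).
Proof. by case=> d ->; exists (c * d); rewrite mulrA. Qed.

Lemma divides_mulr c a b : divides a b -> divides a (b * c).
Proof. by rewrite mulrC; apply: divides_mull. Qed.

Lemma divides_trans b a c : divides a b -> divides b c -> divides a c.
Proof. by move=> [d ->] [e ->]; exists (e * d); rewrite mulrA. Qed.

Lemma divides_refl a : divides a a.
Proof. by exists 1; rewrite mul1r. Qed.

Lemma divides_add a b c : divides a b -> divides a c -> divides a (b + c).
Proof. by move=> [d ->] [e ->]; exists (d + e); rewrite mulrDl. Qed.

Lemma divides_opp a b : divides a b -> divides a (- b).
Proof. by move=> [d ->]; exists (- d); rewrite mulNr. Qed.

Lemma divides0 a : divides a 0.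
Proof. by exists 0; rewrite mul0r. Qed.

Lemma divides_sum (I : Type) (r : seq I) (P : pred I) (F : I -> R) a :
  (forall i, P i -> divides a (F i)) -> divides a (\sum_(i <- r | P i) F i).
Proof.
move=> h; elim/big_ind: _ => //; [exact: divides0 | exact: divides_add].
Qed.

Lemma prime_not_divides_unit p u : prime_elt p -> u \is a GRing.unit ->
  ~ divides p u.
Proof.
move=> [_ pu _] uu [c uE]; case/negP: pu.
by move: uu; rewrite uE unitrM => /andP[].
Qed.

Lemma prime_not_divides1 p : prime_elt p -> ~ divides p 1.
Proof. by move=> pp; apply: prime_not_divides_unit; rewrite ?unitr1. Qed.

(** In q = c p the prime q divides c or p; the former would make p a unit. *)
Lemma prime_divides_prime p q : prime_elt p -> prime_elt q ->
  divides p q -> divides q p.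
Proof.
move=> pp pq [c qE]; have [q0 qu hq] := pq.
have [|[d cE]|//] := hq c p; first by rewrite -qE; exact: divides_refl.
exfalso; apply: (prime_not_divides1 pp); exists d; apply: (mulIf q0).
by rewrite mul1r {1}qE cE -!mulrA; congr (_ * _); rewrite mulrC.
Qed.

(** Over the fraction field, [tau] is the multiple [a / c] of [om]; the primes of
the denominator are cancelled one at a time, since none divides all of [om]. *)
Lemma proportional_primitive (I : Type) (om tau : I -> R) c a :
  factorial_domain -> c != 0 ->
  (forall p, prime_elt p -> exists i, ~ divides p (om i)) ->
  (forall i, c * tau i = a * om i) ->
  exists a', forall i, tau i = a' * om i.
Proof.
move=> fR c0 prim; have [u [s [uu + cE]]] := fR c c0; rewrite {}cE {c c0}.
elim: s a => [|p s IHs] a ps tauE.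
  exists (u^-1 * a) => i; apply: (mulrI uu).
  by have := tauE i; rewrite big_nil mulr1 => ->; rewrite !mulrA mulrV ?mul1r.
have pp : prime_elt p by apply: ps; rewrite mem_head.
have [i0 pi0] := prim p pp; have [p0 _ hp] := pp.
have [|[b aE]|//] := hp a (om i0).
  by rewrite -tauE big_cons; exists (u * \prod_(j <- s) j * tau i0);
     rewrite (mulrC p) !mulrA mulrAC.
apply: (IHs b) => [q qs|i]; first by apply: ps; rewrite in_cons qs orbT.
apply: (mulfI p0); rewrite [RHS]mulrA (mulrC p b) -aE -tauE big_cons.
by rewrite !mulrA (mulrC p u).
Qed.

End Factorial.

(** Needed because the multivariate polynomials are only isomorphic to iterated
univariate ones. *)
Lemma factorial_domain_bij (R S : idomainType) (f : {rmorphism R -> S}) g :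
  cancel f g -> cancel g f -> factorial_domain R -> factorial_domain S.
Proof.
move=> fK gK fR a a0.
have inj := can_inj fK; have f0 x : (f x == 0) = (x == 0).
  by rewrite -(rmorph0 f) (inj_eq inj).
have fu x : f x \is a GRing.unit -> x \is a GRing.unit.
  move=> fxu; apply/unitrP; exists (g (f x)^-1).
  by split; apply: inj; rewrite rmorphM gK rmorph1 ?mulVr ?mulrV.
have fdiv x y : divides (f x) (f y) <-> divides x y.
  split=> [[c h]|[c ->]]; last by exists (f c); rewrite rmorphM.
  by exists (g c); apply: inj; rewrite rmorphM gK.
have [u [s [uu ps gaE]]] : exists (u : R) (s : seq R), [/\ u \is a GRing.unit,
    {in s, forall p, prime_elt p} & g a = u * \prod_(p <- s) p].
  by apply: fR; rewrite -f0 gK.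
exists (f u), (map f s); split.
- exact: rmorph_unit.
- move=> _ /mapP[p ps' ->]; have [p0 pu hp] := ps p ps'; split.
  + by rewrite f0.
  + by apply: contra pu; apply: fu.
  + move=> x y; rewrite -(gK x) -(gK y) -rmorphM !fdiv; exact: hp.
- by rewrite big_map -rmorph_prod -rmorphM -gaE gK.
Qed.

Section FactorialPoly.
Variable R : idomainType.
Hypothesis fR : factorial_domain R.
Implicit Types (p q : {poly R}).

Lemma divides_polyC (a b : R) : divides a%:P b%:P <-> divides a b.
Proof.
split=> [[c]|[c ->]]; last by exists c%:P; rewrite polyCM.
by move/(congr1 (coefp 0)); rewrite /= coefMC !coefC /=; exists c`_0.
Qed.

Lemma divides_polyC_coef (a : R) p i : divides a%:P p -> divides a p`_i.
Proof. by case=> c ->; rewrite coefMC; exists c`_i. Qed.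

Lemma size_sub_lead p : p != 0 ->
  (size (p - (lead_coef p)%:P * 'X^((size p).-1))%R < size p)%N.
Proof.
move=> p0; rewrite -size_poly_gt0 in p0; apply: leq_ltn_trans (_ : ((size p).-1 < _)%N);
  last by rewrite prednK.
apply/leq_sizeP => j; rewrite coefB coefCM coefXn leq_eqVlt => /orP[/eqP<-|hj].
  by rewrite eqxx mulr1 subrr.
by rewrite gtn_eqF // mulr0 subr0 nth_default // -(prednK p0).
Qed.

(** Gauss's lemma: compare leading coefficients and remove the leading term
that the prime divides. *)
Lemma prime_polyC (a : R) : prime_elt a -> prime_elt a%:P.
Proof.
move=> pa; have [a0 au ha] := pa; split; first by rewrite polyC_eq0.
  by rewrite poly_unitE coefC eqxx negb_and au orbT.
move=> p q; have [n] := ubnP (size p + size q).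
elim: n p q => // n IHn p q; rewrite ltnS => szn hpq.
have [->|p0] := eqVneq p 0; first by left; exact: divides0.
have [->|q0] := eqVneq q 0; first by right; exact: divides0.
have rem (r : {poly R}) : divides a (lead_coef r) ->
  divides a%:P ((lead_coef r)%:P * 'X^((size r).-1)).
  by move=> h; apply: divides_mulr; apply/divides_polyC.
have add (r h : {poly R}) :
    divides a%:P h -> divides a%:P (r - h) -> divides a%:P r.
  by move=> h1 h2; rewrite -(subrK h r); apply: divides_add.
have := @divides_polyC_coef a (p * q) (size (p * q)).-1 hpq.
rewrite -lead_coefE lead_coefM => /ha[/rem hp|/rem hq].
  have [||/(add _ _ hp)|] := IHn (p - (lead_coef p)%:P * 'X^((size p).-1)) q; auto.
    by apply: leq_trans szn; rewrite ltn_add2r size_sub_lead.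
  rewrite mulrBl; apply: divides_add => //; apply: divides_opp.
  exact: divides_mulr.
have [||?|/(add _ _ hq)] := IHn p (q - (lead_coef q)%:P * 'X^((size q).-1)); auto.
  by apply: leq_trans szn; rewrite ltn_add2l size_sub_lead.
rewrite mulrBr; apply: divides_add => //; apply: divides_opp.
exact: divides_mull.
Qed.

(** A prime of the denominator [c] divides [g] or [q] and cancels there; constants
being cancelled, the sizes do not change. *)
Lemma clear_denominator (c : R) (p g q : {poly R}) : c != 0 -> c *: p = g * q ->
  exists g' q' : {poly R}, [/\ size g' = size g, size q' = size q & p = g' * q'].
Proof.
move=> c0; have [u [s [uu + cE]]] := fR c0; rewrite {}cE {c c0}.
elim: s g q => [|a s IHs] g q ps pE.
  exists (u^-1 *: g), q; rewrite size_scale ?invr_eq0; last first.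
    by apply: contraTneq uu => ->; rewrite unitr0.
  split=> //; move: pE; rewrite big_nil mulr1 -scalerAl => <-.
  by rewrite scalerA mulVr ?scale1r.
have pa : prime_elt a by apply: ps; rewrite mem_head.
have ps' : {in s, forall b, prime_elt b}.
  by move=> b bs; apply: ps; rewrite in_cons bs orbT.
have [aP0 _ ha] := prime_polyC pa; have a0 : a != 0 by case: pa.
have aE : (u * \prod_(i <- a :: s) i) *: p = a%:P * ((u * \prod_(i <- s) i) *: p).
  by rewrite mul_polyC scalerA big_cons !mulrA (mulrC u a).
have sz (r d : {poly R}) : r = d * a%:P -> size d = size r.
  by move=> ->; rewrite mulrC mul_polyC size_scale.
have [|[d dE]|[d dE]] := ha g q.
- by rewrite -pE aE; exists ((u * \prod_(i <- s) i) *: p); rewrite mulrC.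
- have [//||g' [q' [sg sq ->]]] := IHs d q; last first.
    by exists g', q'; rewrite -(sz _ _ dE).
  by apply: (mulfI aP0); rewrite -aE pE dE -mulrA mulrCA.
- have [//||g' [q' [sg sq ->]]] := IHs g d; last first.
    by exists g', q'; rewrite -(sz _ _ dE).
  by apply: (mulfI aP0); rewrite -aE pE dE mulrA mulrC.
Qed.

(** The primes of [c] do not divide [p], so all of them cancel against [r]. *)
Lemma cancel_primitive (c : R) p q r : c != 0 ->
  (forall a, prime_elt a -> ~ divides a%:P p) -> c *: q = r * p -> divides p q.
Proof.
move=> c0 prim; have [u [s [uu + cE]]] := fR c0; rewrite {}cE {c c0}.
elim: s r => [|a s IHs] r ps qE.
  exists (u^-1 *: r); move: qE; rewrite big_nil mulr1 -scalerAl => <-.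
  by rewrite scalerA mulVr ?scale1r.
have pa : prime_elt a by apply: ps; rewrite mem_head.
have [aP0 _ ha] := prime_polyC pa.
have aE : (u * \prod_(i <- a :: s) i) *: q = a%:P * ((u * \prod_(i <- s) i) *: q).
  by rewrite mul_polyC scalerA big_cons !mulrA (mulrC u a).
have [|[d dE]|/(prim _ pa)//] := ha r p.
  by rewrite -qE aE; exists ((u * \prod_(i <- s) i) *: q); rewrite mulrC.
apply: (IHs d) => [b bs|]; first by apply: ps; rewrite in_cons bs orbT.
by apply: (mulfI aP0); rewrite -aE qE dE -mulrA mulrCA.
Qed.

(** Over the fraction field, [p] is irreducible, so it is coprime to [a] or divides
it; pseudo-division gives both cases up to a constant, which
[cancel_primitive] and [clear_denominator] remove. *)
Lemma prime_indecomposable p : (1 < size p)%N ->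
  (forall a, prime_elt a -> ~ divides a%:P p) ->
  (forall a b, p = a * b -> (size a <= 1)%N \/ (size b <= 1)%N) ->
  prime_elt p.
Proof.
move=> szp prim indec; have p0 : p != 0 by rewrite -size_poly_gt0 ltnW.
have pdiv q : Pdiv.Field.dvdp p q -> divides p q.
  case/Pdiv.Idomain.dvdpP => -[c r] /= c0 qE.
  exact: cancel_primitive c0 prim qE.
split=> //.
  by rewrite poly_unitE negb_and gtn_eqF.
move=> a b [c abE]; have abp : Pdiv.Field.dvdp p (a * b).
  by rewrite abE; apply: Pdiv.Idomain.dvdp_mull.
have [cop|ncop] := boolP (Pdiv.Field.coprimep p a).
  by right; apply: pdiv; rewrite -(Pdiv.Idomain.Gauss_dvdpr _ cop).
left; apply: pdiv; set g := Pdiv.Field.gcdp p a.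
have gp : Pdiv.Field.dvdp g p by apply: Pdiv.Idomain.dvdp_gcdl.
have ga : Pdiv.Field.dvdp g a by apply: Pdiv.Idomain.dvdp_gcdr.
have szg : (1 < size g)%N.
  rewrite ltn_neqAle eq_sym -Pdiv.Idomain.coprimep_def ncop size_poly_gt0.
  by rewrite Pdiv.Idomain.gcdp_eq0 negb_and p0.
have /Pdiv.Idomain.dvdpP[[d q] /= d0 pE] := gp.
have [q' [g' [szq szg' pE']]] := clear_denominator d0 pE.
suff : size g == size p.
  by rewrite (Pdiv.Idomain.dvdp_size_eqp gp) => /Pdiv.Idomain.eqp_dvdl <-.
have [q'0 g'0] : q' != 0 /\ g' != 0.
  by apply/andP; rewrite -negb_or -mulf_eq0 -pE'.
have [h|h] := indec _ _ pE'; last by rewrite leqNgt szg' szg in h.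
rewrite -szg' pE' size_mul //.
by move: q'0 h; rewrite -size_poly_gt0; case: (size q') => [|[]].
Qed.

(** Constant primes dividing [p] divide its leading coefficient, so it is enough to
try the prime factors of the latter once each. *)
Lemma extract_content p : p != 0 -> exists (s : seq R) (p' : {poly R}),
  [/\ {in s, forall a, prime_elt a}, p = (\prod_(a <- s) a) *: p'
    & forall a, prime_elt a -> ~ divides a%:P p'].
Proof.
move=> p0; have [u [s [uu + lE]]] : exists (u : R) (s : seq R), [/\ u \is a GRing.unit,
    {in s, forall a, prime_elt a} & lead_coef p = u * \prod_(a <- s) a].
  by apply: fR; rewrite lead_coef_eq0.
have : forall a, prime_elt a -> divides a u -> ~ divides a%:P p.
  by move=> a pa /(prime_not_divides_unit pa uu).
(* The part [d] of the leading coefficient is made of primes already examined. *)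
elim: s u p {p0 uu} lE => [|a s IHs] d p lE hd ps.
  exists [::], p; split=> [//||a pa]; first by rewrite big_nil scale1r.
  move=> ap; apply: (hd a pa) => //; move: lE; rewrite big_nil mulr1 => <-.
  exact: divides_polyC_coef.
have pa : prime_elt a by apply: ps; rewrite mem_head.
have ps' : {in s, forall b, prime_elt b}.
  by move=> b bs; apply: ps; rewrite in_cons bs orbT.
have [a0 _ _] := pa.
have [[q qE]|nap] := classic (divides a%:P p).
  have [|b pb bd [r rE]||s' [p' [ps'' qE' hp']]] := IHs d q.
  - apply: (mulIf a0); rewrite -[X in _ * X](lead_coefC a) -lead_coefM -qE lE big_cons.
    by rewrite mulrAC -!mulrA.
  - by apply: (hd b pb bd); rewrite qE rE; exists (r * a%:P); rewrite mulrAC.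
  - exact: ps'.
  exists (a :: s'), p'; split=> //.
    by move=> b; rewrite in_cons => /orP[/eqP->//|/ps''].
  by rewrite qE {1}qE' big_cons -scalerA -[RHS]mul_polyC mulrC.
apply: (IHs (d * a)) => //; first by rewrite lE big_cons mulrA.
move=> b pb; have [_ _ hb] := pb => /hb[/(hd b pb)//|ba bp]; apply: nap.
apply: divides_trans bp; apply/divides_polyC; exact: prime_divides_prime pb pa ba.
Qed.

(** A polynomial which is not a product of two nonconstant ones is, up to its content,
prime by [prime_indecomposable]; the others are split by induction on the degree. *)
Lemma factorial_poly : factorial_domain {poly R}.
Proof.
move=> p; have [n] := ubnP (size p); elim: n p => // n IHn p.
rewrite ltnS => szp p0.
have const (c : R) (q : {poly R}) (s : seq {poly R}) : c != 0 ->
    {in s, forall r, prime_elt r} -> q = c *: \prod_(r <- s) r ->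
    exists (u : {poly R}) (s : seq {poly R}), [/\ u \is a GRing.unit,
    {in s, forall p, prime_elt p} & q = u * \prod_(p <- s) p].
  move=> c0 ps qE; have [u [t [uu pt cE]]] := fR c0.
  exists u%:P, (map polyC t ++ s); split.
  - exact: rmorph_unit.
  - by move=> r; rewrite mem_cat => /orP[/mapP[a /pt/prime_polyC ? ->]//|/ps].
  - by rewrite big_cat big_map -rmorph_prod mulrA -polyCM -cE mul_polyC.
have [szp1|szp1] := leqP (size p) 1.
  have pE := size1_polyC szp1.
  apply: (const p`_0 p [::]) => //; first by rewrite -polyC_eq0 -pE.
  by rewrite big_nil alg_polyC.
have [[a [b [pE sza szb]]]|indec] := classic (exists a b,
    [/\ p = a * b, (1 < size a)%N & (1 < size b)%N]).
  have [a0 b0] : a != 0 /\ b != 0.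
    by apply/andP; rewrite -negb_or -mulf_eq0 -pE.
  have szE : size p = (size a + size b).-1 by rewrite pE size_mul.
  have [|u [s [uu ps aE]]] := IHn a _ a0.
    apply: leq_trans szp; rewrite szE; case: (size b) szb => [|[]]// k _.
    by rewrite !addnS /= ltnS leq_addr.
  have [|v [t [vu pt bE]]] := IHn b _ b0.
    apply: leq_trans szp; rewrite szE; case: (size a) sza => [|[]]// k _.
    by rewrite !addSn /= ltnS leq_addl.
  exists (u * v), (s ++ t); split; first by rewrite unitrM uu.
    by move=> r; rewrite mem_cat => /orP[/ps|/pt].
  by rewrite big_cat pE aE bE mulrACA.
have [s [p' [ps pE prim]]] := extract_content p0.
have s0 : \prod_(a <- s) a != 0.
  by apply: contraNneq p0 => h; rewrite pE h scale0r.
apply: (const (\prod_(a <- s) a) p [:: p']) => //; last by rewrite big_seq1.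
move=> r; rewrite inE => /eqP->; apply: prime_indecomposable => //.
  by move: szp1; rewrite pE size_scale.
move=> a b p'E; have [|sza] := leqP (size a) 1; first by left.
have [|szb] := leqP (size b) 1; first by right.
case: indec; exists (\prod_(a <- s) a *: a), b; split=> //.
  by rewrite pE p'E scalerAl.
by rewrite size_scale.
Qed.
End FactorialPoly.

Section MpolyPoly.
Variables (n : nat) (F : idomainType).
Local Notation widen := (widen_ord (leqnSn n)).

Definition muni_inv (p : {poly {mpoly F[n]}}) : {mpoly F[n.+1]} :=
  (mpwiden p).['X_ord_max].

Lemma muni_inv_is_additive : additive muni_inv.
Proof. by move=> p q; rewrite /muni_inv raddfB hornerD hornerN. Qed.

Lemma muni_inv_is_multiplicative : multiplicative muni_inv.
Proof.
split=> [p q|]; first by rewrite /muni_inv rmorphM hornerM.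
by rewrite /muni_inv rmorph1 hornerC.
Qed.

HB.instance Definition _ := GRing.isAdditive.Build
  {poly {mpoly F[n]}} {mpoly F[n.+1]} muni_inv muni_inv_is_additive.
HB.instance Definition _ := GRing.isMultiplicative.Build
  {poly {mpoly F[n]}} {mpoly F[n.+1]} muni_inv muni_inv_is_multiplicative.

Lemma muniX (m : 'X_{1..n.+1}) : muni ('X_[m] : {mpoly F[n.+1]}) =
  'X_[[multinom (m (widen i)) | i < n]] *: 'X^(m ord_max).
Proof. by rewrite muniE msuppX big_seq1 mcoeffX eqxx scale1r. Qed.

Lemma muni_mwiden (c : {mpoly F[n]}) : muni (mwiden c) = c%:P.
Proof.
rewrite (mpolyE c) (raddf_sum (@mwiden n F)) (raddf_sum (@muni n F)) (raddf_sum polyC).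
apply: eq_bigr => m _ /=.
rewrite mwidenZ muniZ mwidenX muniX mnmwiden_ordmax expr0 alg_polyC.
rewrite -mul_polyC -polyCM mul_mpolyC; congr (_ *: 'X_[_])%:P.
by apply/mnmP => i; rewrite mnmE mnmwiden_widen.
Qed.

Lemma muni_invC c : muni_inv c%:P = mwiden c.
Proof. by rewrite /muni_inv mpwidenC hornerC. Qed.

Lemma muni_invX : muni_inv 'X = 'X_ord_max.
Proof. by rewrite /muni_inv mpwidenX hornerX. Qed.

Lemma muni_invK : cancel muni_inv (@muni n F).
Proof.
elim/poly_ind => [|p c IHp]; first by rewrite !rmorph0.
rewrite rmorphD rmorphM /= muni_invC muni_invX rmorphD rmorphM /= IHp muni_mwiden.
congr (_ * _ + _); rewrite muniX mnm1E eqxx expr1.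
rewrite -[RHS]scale1r -mpolyX0; congr ('X_[_] *: _).
by apply/mnmP => i; rewrite mnmE mnm0E mnm1E -val_eqE /= gtn_eqF.
Qed.

Lemma muniK : cancel (@muni n F) muni_inv.
Proof.
move=> p; rewrite {2}(mpolyE p) muniE raddf_sum; apply: eq_bigr => m _ /=.
rewrite -mul_mpolyC -mul_polyC -!mul_mpolyC rmorphM /= rmorphXn /=.
rewrite muni_invX muni_invC rmorphM /= mwidenC mwidenX -mulrA mpolyXn -mpolyXD.
congr (_ * 'X_[_]); apply/mnmP => i; rewrite mnmDE mulmnE mnm1E.
case: (unliftP ord_max i) => [j ->|->].
  have -> : fintype.lift ord_max j = widen j.
    by apply: val_inj; rewrite /= /bump leqNgt (ltn_ord j).
  by rewrite mnmwiden_widen mnmE -val_eqE /= gtn_eqF // addn0.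
by rewrite mnmwiden_ordmax eqxx mul1n.
Qed.
End MpolyPoly.

Lemma factorial_mpoly n (F : fieldType) : factorial_domain {mpoly F[n]}.
Proof.
elim: n => [|n IHn].
  move=> p p0; exists p, [::]; rewrite big_nil mulr1; split=> //.
  apply/andP; rewrite unitfE; split; first by rewrite -nvar0_mpolyC.
  by apply: contraNneq p0 => h; rewrite (nvar0_mpolyC p) h.
exact: (factorial_domain_bij (@muni_invK n F) (@muniK n F) (factorial_poly IHn)).
Qed.

(** * Eventually polynomial sequences and counting monomials outside an ideal *)

Definition eventually (P : nat -> Prop) :=
  exists t0 : nat, forall t, (t0 <= t)%N -> P t.

Lemma eventually_and (P Q : nat -> Prop) :
  eventually P -> eventually Q -> eventually (fun t => P t /\ Q t).
Proof.
move=> [a hP] [b hQ]; exists (maxn a b) => t; rewrite geq_max => /andP[? ?].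
by split; auto.
Qed.

Lemma eventually_impl (P Q : nat -> Prop) :
  (forall t, P t -> Q t) -> eventually P -> eventually Q.
Proof. by move=> PQ [t0 hP]; exists t0 => t /hP/PQ. Qed.

(** Eventual agreement with a polynomial of degree less than [k], expressed by finite
differences: this keeps all values integral. *)
Fixpoint vanishing_diff (k : nat) (G : nat -> int) : Prop :=
  if k is k'.+1 then vanishing_diff k' (fun t => G t.+1 - G t)
  else eventually (fun t => G t = 0).

Lemma vanishing_diff_ev k (G H : nat -> int) : eventually (fun t => G t = H t) ->
  vanishing_diff k G -> vanishing_diff k H.
Proof.
elim: k G H => [|k IHk] G H /= e.
  by move=> /(eventually_and e); apply: eventually_impl => t [<-].
apply: IHk; case: e => t0 e; exists t0 => t lt; rewrite !e //; exact: leqW.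
Qed.

Lemma vanishing_diff_eq k (G H : nat -> int) : G =1 H ->
  vanishing_diff k G -> vanishing_diff k H.
Proof. by move=> e; apply: vanishing_diff_ev; exists 0%N. Qed.

Lemma vanishing_diffD k G H : vanishing_diff k G -> vanishing_diff k H ->
  vanishing_diff k (fun t => G t + H t).
Proof.
elim: k G H => [|k IHk] G H /= hG hH.
  by have := eventually_and hG hH; apply: eventually_impl => t [-> ->].
by apply: vanishing_diff_eq (IHk _ _ hG hH) => t; lia.
Qed.

Lemma vanishing_diff_shift k G :
  vanishing_diff k (fun t => G t.+1) <-> vanishing_diff k G.
Proof.
elim: k G => [|k IHk] G /=; last exact: IHk (fun t => G t.+1 - G t).
split=> [[t0 h]|[t0 h]]; last by exists t0 => t ht; apply: h; apply: leqW.
by exists t0.+1 => -[//|t] ht; apply: h.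
Qed.

Lemma vanishing_diffS k G : vanishing_diff k G -> vanishing_diff k.+1 G.
Proof.
elim: k G => [|k IHk] G; last exact: IHk.
by case=> t0 h; exists t0 => t ht; rewrite !h //; apply: leqW.
Qed.

Lemma eventually_large (G : nat -> int) M :
  eventually (fun t => G t.+1 - G t >= 1) -> eventually (fun t => G t >= M).
Proof.
move=> [t0 h]; have grow t : G (t0 + t)%N >= G t0 + t%:Z.
  elim: t => [|t IHt]; first by rewrite addn0 addr0.
  by rewrite addnS; have := h (t0 + t)%N (leq_addr _ _); lia.
exists (t0 + `|M - G t0|)%N => t ht; have := grow (t - t0)%N.
by rewrite subnKC; lia.
Qed.

(** By induction, the difference of [G] has an eventual sign; if it is nonzero then [G]
is eventually large, with that sign. *)
Lemma vanishing_diff_sign k G : vanishing_diff k G ->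
  [\/ eventually (fun t => G t = 0), eventually (fun t => G t >= 1)
    | eventually (fun t => - G t >= 1)].
Proof.
elim: k G => [|k IHk] G; first by constructor 1.
move=> /IHk[[t0 h]|/(eventually_large 1)|h]; last 1 first.
- constructor 3; apply: (eventually_large 1); apply: eventually_impl h => t; lia.
- have cst t : (t0 <= t)%N -> G t = G t0.
    elim: t => [|t IHt]; first by rewrite leqn0 => /eqP->.
    rewrite leq_eqVlt => /orP[/eqP->//|]; rewrite ltnS => lt.
    by have := h t lt; rewrite (IHt lt); lia.
  have [g|[g|g]] : G t0 = 0 \/ G t0 >= 1 \/ - G t0 >= 1 by lia.
  + by constructor 1; exists t0 => t /cst->.
  + by constructor 2; exists t0 => t /cst->.
  + by constructor 3; exists t0 => t /cst->.
- by constructor 2.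
Qed.

Lemma eventually_false : ~ eventually (fun=> False).
Proof. by case=> t0 /(_ t0 (leqnn _)). Qed.

(** The second difference has an eventual sign, and a nonzero one would force
superlinear growth, upwards or downwards. *)
Lemma eventually_linear k H (C D : int) : vanishing_diff k H ->
  (forall t, 0 <= H t) -> eventually (fun t => H t <= C * t%:Z + D) ->
  exists b c, eventually (fun t => H t = b * t%:Z + c).
Proof.
move=> /vanishing_diffS/vanishing_diffS/= hH ge0 leC.
case: (vanishing_diff_sign hH) => [[t0 h]|h|h].
- exists (H t0.+1 - H t0), (H t0 - (H t0.+1 - H t0) * t0%:Z), t0 => t ht.
  rewrite -(subnKC ht); elim: (t - t0)%N => [|j [IHj]] {t ht}.
    by rewrite addn0; lia.
  have cst i : H (t0 + i).+1 - H (t0 + i)%N = H t0.+1 - H t0.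
    elim: i => [|i IHi]; first by rewrite addn0.
    by have := h (t0 + i)%N (leq_addr _ _); rewrite -IHi addnS; lia.
  by have := cst j; rewrite addnS; lia.
- have /(eventually_large (C + 1)) := h => {}h.
  have : eventually (fun t => H t - C * t%:Z >= D + 1).
    by apply: eventually_large; apply: eventually_impl h => t; lia.
  move=> h'; case: eventually_false.
  by apply: eventually_impl (eventually_and leC h') => t; lia.
- have : eventually (fun t => - (H t.+1 - H t) >= 1).
    by apply: eventually_large; apply: eventually_impl h => t; lia.
  move=> h'; have : eventually (fun t => - H t >= 1).
    by apply: eventually_large; apply: eventually_impl h' => t; lia.
  move=> h''; case: eventually_false; apply: eventually_impl h'' => t.
  by have := ge0 t; lia.
Qed.

Lemma slope_bounds (b c A C : int) :
  eventually (fun t => 0 <= b * t%:Z + c <= A * t%:Z + C) -> 0 <= b <= A.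
Proof.
move=> [t0 h]; apply/andP; split.
  have := h (t0 + `|c| + 1)%N; rewrite -addnA leq_addr => /(_ isT) /andP[+ _].
  by nia.
have := h (t0 + `|c| + `|C| + 1)%N; rewrite -!addnA leq_addr => /(_ isT) /andP[_].
by nia.
Qed.

Definition incr_head (s : seq nat) := if s is a :: s' then a.+1 :: s' else [::].

(** The exponent vectors of degree [t] in [n] variables.  They are generated according
to whether the first exponent vanishes, because the count of those outside an
up-closed set is studied through the recursion [gap_countSS] on that exponent. *)
Fixpoint exponents (n : nat) : nat -> seq (seq nat) :=
  if n is n'.+1 then
    fix exponents_S t := map (cons 0%N) (exponents n' t) ++
      (if t is t'.+1 then map incr_head (exponents_S t') else [::])
  else fun t => if t is 0 then [:: [::]] else [::].

Lemma exponentsS0 n : exponents n.+1 0 = map (cons 0%N) (exponents n 0).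
Proof. by rewrite /= cats0. Qed.

Lemma exponentsSS n t : exponents n.+1 t.+1 =
  map (cons 0%N) (exponents n t.+1) ++ map incr_head (exponents n.+1 t).
Proof. by []. Qed.

Arguments exponents : simpl never.

Lemma mem_exponents n t s :
  (s \in exponents n t) = (size s == n) && (sumn s == t).
Proof.
elim: n t s => [|n IHn] t s.
  by case: t s => [|t] [|a s].
have cons0 t' a s' : (a :: s' \in map (cons 0%N) (exponents n t')) =
    (a == 0%N) && (s' \in exponents n t').
  apply/mapP/andP => [[x xin [-> ->]]//|[/eqP-> ?]]; by exists s'.
have nil0 t' : ([::] \in map (cons 0%N) (exponents n t')) = false by apply/mapP => -[].
elim: t s => [|t IHt] [|a s]; rewrite ?exponentsS0 ?exponentsSS ?mem_cat ?cons0 ?nil0 /=.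
- by [].
- by rewrite IHn eqSS addn_eq0; case: (a == 0%N); rewrite /= ?andbF.
- by apply/negbTE/mapP => -[[|b x]] //; rewrite IHt.
rewrite IHn eqSS; case: a => [|a]; rewrite /= ?add0n ?orFb; last first.
  apply/mapP/idP => [[[|b x]]|/andP[/eqP sz /eqP sm]].
  - by rewrite IHt.
  - by rewrite IHt /= eqSS => /andP[/eqP <- /eqP<-] [<- <-]; rewrite !eqxx.
  - by exists (a :: s) => //; rewrite IHt /= sz eqxx; lia.
case: andP => //= _; apply/mapP => -[[|b x]] //.
Qed.

Lemma exponents_uniq n t : uniq (exponents n t).
Proof.
elim: n t => [|n IHn] t; first by case: t.
have injc : injective (cons 0%N) by move=> x y [].
elim: t => [|t IHt]; first by rewrite exponentsS0 map_inj_uniq //; exact: IHn.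
rewrite exponentsSS cat_uniq map_inj_uniq // IHn /=.
rewrite map_inj_in_uniq; last first.
  move=> [|a x] [|b y]; rewrite ?mem_exponents //= => _ _ [-> ->] //.
rewrite IHt andbT; apply/hasPn => s /mapP[[|a x]]; rewrite ?mem_exponents //.
by move=> _ ->; apply/mapP => -[].
Qed.

(** The Hilbert function of the quotient by the monomial ideal with exponents in
[U]. *)
Definition gap_count n (U : pred (seq nat)) t : int :=
  (count (predC U) (exponents n t))%:Z.

Lemma eq_gap_count n U V t : (forall s, size s = n -> U s = V s) ->
  gap_count n U t = gap_count n V t.
Proof.
move=> e; congr Posz; apply: eq_in_count => s; rewrite mem_exponents.
by case/andP => /eqP/e /= ->.
Qed.

Lemma gap_countSS n U t : gap_count n.+1 U t.+1 =
  gap_count n (fun s => U (0%N :: s)) t.+1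
  + gap_count n.+1 (fun s => U (incr_head s)) t.
Proof. by rewrite /gap_count exponentsSS count_cat !count_map PoszD. Qed.

Definition upclosed n (U : pred (seq nat)) :=
  forall s s', size s = n -> all2 leq s s' -> U s -> U s'.

Lemma all2_leq_refl s : all2 leq s s.
Proof. by elim: s => //= a s ->; rewrite leqnn. Qed.

Lemma upclosed_slice n U k : upclosed n.+1 U -> upclosed n (fun s => U (k :: s)).
Proof.
by move=> hU s s' szs le; apply: hU; rewrite /= ?szs // leqnn.
Qed.

(** Dickson's lemma, as an ascending chain condition.  Slice along the first exponent:
once the diagonal chain of slices is stationary, so are all slices of larger index,
and the finitely many others stabilize one by one. *)
Lemma upclosed_chain n (U : nat -> pred (seq nat)) :
  (forall k, upclosed n (U k)) ->
  (forall k s, size s = n -> U k s -> U k.+1 s) ->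
  exists k0, forall k s, (k0 <= k)%N -> size s = n -> U k s = U k0 s.
Proof.
elim: n U => [|n IHn] U up inc.
  have [[k0 hk]|nex] := classic (exists k, U k [::]).
    exists k0 => k [|//] lek _; rewrite hk -(subnKC lek).
    by elim: (k - k0)%N => [|j IHj]; rewrite ?addn0 ?addnS //; apply: inc.
  by exists 0%N => k [|//] _ _; apply/idP/idP => h; case: nex; [exists k | exists 0%N].
have mono k j i i' s : (k <= j)%N -> (i <= i')%N -> size s = n ->
    U k (i :: s) -> U j (i' :: s).
  move=> /subnKC <- lei sz h; elim: (j - k)%N => [|l IHl].
    rewrite addn0; apply: up h; rewrite /= ?sz ?lei //; exact: all2_leq_refl.
  by rewrite addnS; apply: inc; rewrite /= ?sz.
have [|k s sz|k0 hk0] := IHn (fun k s => U k (k :: s)).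
- by move=> k; apply: upclosed_slice.
- exact: mono.
have [J [leJ hJ]] : exists J, (k0 <= J)%N /\ forall i j s, (i < k0)%N -> (J <= j)%N ->
    size s = n -> U j (i :: s) = U J (i :: s).
  elim: {2}k0 => [|i [J [leJ hJ]]]; first by exists k0; split.
  have [|j s sz|j0 hj0] := IHn (fun j s => U j (i :: s)).
  - by move=> j; apply: upclosed_slice.
  - exact: mono.
  exists (maxn J j0); split; first by rewrite leq_max leJ.
  move=> i' j s; rewrite ltnS leq_eqVlt geq_max => /orP[/eqP->|lti] /andP[lej1 lej2] sz.
    by rewrite hj0 // [RHS]hj0 // leq_maxr.
  by rewrite hJ // [RHS]hJ // leq_maxl.
exists J => k [//|i s] lek [sz]; have [ltik0|leik0] := ltnP i k0; first exact: hJ.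
have all j : (k0 <= j)%N -> U j (i :: s) = U k0 (k0 :: s).
  move=> lej; apply/idP/idP => [h|]; last exact: mono.
  rewrite -(hk0 (maxn i j)) ?leq_max ?leik0 //; apply: mono h => //.
    exact: leq_maxr.
  exact: leq_maxl.
by rewrite !all // (leq_trans leJ).
Qed.

(** The slices of [U] along the first exponent are eventually constant.  If they all
agree, the difference of [gap_count n.+1 U] is a [gap_count] in [n] variables;
otherwise shift [U] to drop its first slice. *)
Lemma gap_count_poly n U : upclosed n U -> vanishing_diff n (gap_count n U).
Proof.
elim: n U => [|n IHn] U up; first by exists 1%N => -[].
have [k s sz|k0] := upclosed_chain (U := fun k s => U (k :: s))
  (fun k => upclosed_slice (k := k) up).
  by apply: up; rewrite /= ?sz // leqnSn all2_leq_refl.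
(* Induction on the index from which the slices agree. *)
elim: k0 U up => [|k0 IHk0] U up stab.
  apply: vanishing_diff_eq (iffRL (vanishing_diff_shift _ _)
    (IHn _ (upclosed_slice (k := 0) up))) => t.
  rewrite gap_countSS (eq_gap_count (U := fun s => U (incr_head s)) (V := U)).
    by rewrite addrK.
  by move=> [//|a s] [sz] /=; rewrite stab // [RHS]stab.
apply/vanishing_diff_shift.
apply: (@vanishing_diff_eq _ (fun t => gap_count n (fun s => U (0%N :: s)) t.+1
   + gap_count n.+1 (fun s => U (incr_head s)) t)).
  by move=> t; rewrite gap_countSS.
apply: vanishing_diffD.
  by apply/vanishing_diff_shift/vanishing_diffS/IHn/upclosed_slice.
apply: IHk0 => [[//|a s] [//|b s'] sz /= /andP[le les]|k s lek sz /=].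
  by apply: up; rewrite //= ltnS le.
exact: stab.
Qed.

(** * Hilbert functions of ideals through leading monomials *)

Definition asbool (P : Prop) : bool :=
  if excluded_middle_informative P then true else false.

Lemma asboolP P : reflect P (asbool P).
Proof. by rewrite /asbool; case: excluded_middle_informative => h; constructor. Qed.

Lemma mpolyX_neq0 (K : fieldType) n (m : 'X_{1..n}) : 'X_[m] != 0 :> {mpoly K[n]}.
Proof. by rewrite -msupp_eq0 msuppX. Qed.

Section LeadCount.
Variables (K : fieldType) (n t : nat).
Local Notation V := (dhomog n.+1 K t).

Definition coef_dhomog (m : 'X_{1..n.+1}) (p : V) : K^o := (p : {mpoly K[n.+1]})@_m.

Lemma coef_dhomog_is_linear m : linear (coef_dhomog m).
Proof. by move=> a p q; rewrite /coef_dhomog !linearP. Qed.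

HB.instance Definition _ m := GRing.isLinear.Build K V K^o _ (coef_dhomog m)
  (coef_dhomog_is_linear m).

(** Turned into a boolean so that leading monomials can be counted. *)
Definition is_lead (P : {mpoly K[n.+1]} -> Prop) (m : 'X_{1..n.+1}) :=
  asbool (exists p, [/\ P p, p != 0 & mlead p = m]).

Definition in_vspace (W : {vspace V}) (p : {mpoly K[n.+1]}) :=
  exists2 w : V, w \in W & p = w.

(** Coefficient extraction at the largest remaining monomial lowers the dimension by
one exactly when that monomial is a leading one. *)
Lemma dim_lead_sorted (s : seq 'X_{1..n.+1}) (W : {vspace V}) :
  sorted (fun a b => (b < a)%O) s ->
  (forall p : V, p \in W -> {subset msupp (p : {mpoly K[n.+1]}) <= s}) ->
  \dim W = count (is_lead (in_vspace W)) s.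
Proof.
elim: s W => [|m s IHs] W srt supp.
  apply/eqP; rewrite dimv_eq0 -subv0; apply/subvP => p /supp h.
  rewrite memv0; apply/eqP/val_inj/mpolyP => m /=; rewrite mcoeff0.
  by apply/eqP; rewrite mcoeff_eq0; apply/negP => /h.
have tr : transitive (fun a b : 'X_{1..n.+1} => (b < a)%O).
  by move=> x y z h1 h2; apply: lt_trans h2 h1.
rewrite /= path_sortedE // in srt; have /andP[/allP lts srts] := srt.
pose f := linfun (coef_dhomog m).
have fE p : f p = (p : {mpoly K[n.+1]})@_m by rewrite lfunE.
have kerP p : (p \in lker f) = ((p : {mpoly K[n.+1]})@_m == 0) by rewrite memv_ker fE.
rewrite -(limg_ker_dim f W) addnC /=; congr (_ + _)%N.
  rewrite /is_lead; case: asboolP => [[q [[p pW ->] p0 lp]]|nl].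
    apply/eqP; rewrite eqn_leq (leq_trans (dimvS (subvf _))) ?dimvf //= lt0n dimv_eq0.
    apply/negP => /eqP h; have := memv_img f pW.
    rewrite h memv0 fE -lp => /eqP e; move: (mlead_supp p0).
    by rewrite mcoeff_msupp e eqxx.
  apply/eqP; rewrite dimv_eq0 -subv0; apply/subvP => _ /memv_imgP[p pW ->].
  rewrite memv0 fE; apply/eqP; apply: NNPP => pm; apply: nl.
  exists p; split; [by exists p| |].
    by apply: contra_notN pm => /eqP->; rewrite mcoeff0.
  apply/le_anti/andP; split; last first.
    by rewrite leNgt; apply/negP => /mcoeff_gt_mlead.
  have p0 : (p : {mpoly K[n.+1]}) != 0.
    by apply: contra_notN pm => /eqP->; rewrite mcoeff0.
  by have := supp p pW _ (mlead_supp p0); rewrite in_cons => /orP[/eqP->|/lts/ltW].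
rewrite IHs //; last first.
  move=> p; rewrite memv_cap kerP => /andP[pW pm] m' m'p.
  have := supp p pW _ m'p; rewrite in_cons => /orP[/eqP e|//].
  by move: m'p; rewrite e mcoeff_msupp pm.
apply: eq_in_count => m' /lts lt'; apply/asboolP/asboolP => -[q [[p pW ->] p0 lp]].
  exists p; split=> //; exists p => //; move: pW; by rewrite memv_cap => /andP[].
exists p; split=> //; exists p => //; rewrite memv_cap pW kerP /=.
by apply/eqP/mcoeff_gt_mlead; rewrite lp.
Qed.

Lemma dim_lead (s : seq 'X_{1..n.+1}) (W : {vspace V}) : uniq s ->
  (forall m, (m \in s) = (mdeg m == t)) ->
  \dim W = count (is_lead (in_vspace W)) s.
Proof.
move=> us memt; pose r := sort (fun a b => (b <= a)%O) s.
have tot : total (fun a b : 'X_{1..n.+1} => (b <= a)%O).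
  by move=> a b; apply: le_total.
rewrite -(permP (permEl (perm_sort (fun a b => (b <= a)%O) s))).
apply: dim_lead_sorted.
  have := sort_sorted tot s; rewrite -/r.
  have : uniq r by rewrite sort_uniq.
  elim: r => //= a r IHr /andP[ar ur] pr; have sr := path_sorted pr.
  have tr : transitive (fun a b : 'X_{1..n.+1} => (b <= a)%O).
    by move=> x y z h1 h2; apply: le_trans h2 h1.
  have tr' : transitive (fun a b : 'X_{1..n.+1} => (b < a)%O).
    by move=> x y z h1 h2; apply: lt_trans h2 h1.
  rewrite path_sortedE // IHr // andbT; apply/allP => b br.
  move: pr; rewrite path_sortedE // => /andP[/allP/(_ b br) le _].
  by rewrite lt_neqAle le andbT; apply: contraNneq ar => <-.
move=> p pW m mp; rewrite mem_sort memt; apply/eqP.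
exact: (dhomog_mf (valP p)).
Qed.
End LeadCount.

Definition mnm_of_seq n (s : seq nat) : 'X_{1..n} := [multinom nth 0%N s i | i < n].

Lemma mdeg_mnm_of_seq n s : size s = n -> mdeg (mnm_of_seq n s) = sumn s.
Proof.
move=> <-; rewrite mdegE sumnE (big_nth 0%N) big_mkord.
by apply: eq_bigr => i _; rewrite mnmE.
Qed.

Lemma mnm_of_seq_inj n t : {in exponents n t &, injective (mnm_of_seq n)}.
Proof.
move=> s s'; rewrite !mem_exponents => /andP[/eqP sz _] /andP[/eqP sz' _] e.
apply: (@eq_from_nth _ 0%N) => [|i]; first by rewrite sz sz'.
rewrite sz => lti.
by have := congr1 (fun m : 'X_{1..n} => m (Ordinal lti)) e; rewrite !mnmE.
Qed.

Lemma mem_mnm_exponents n t (m : 'X_{1..n}) :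
  (m \in map (mnm_of_seq n) (exponents n t)) = (mdeg m == t).
Proof.
apply/mapP/eqP => [[s]|<-].
  by rewrite mem_exponents => /andP[/eqP sz /eqP <-] ->; rewrite mdeg_mnm_of_seq.
have mE : m = mnm_of_seq n (multinom_val m).
  by apply/mnmP => i; rewrite mnmE -mnm_nth.
exists (multinom_val m : seq nat) => //; rewrite mem_exponents size_tuple eqxx /=.
by rewrite -(mdeg_mnm_of_seq (n := n)) ?size_tuple // -mE.
Qed.

Section Ideal.
Variables (K : fieldType) (n : nat).
Local Notation R := {mpoly K[n.+1]}.
Implicit Types (p q : R).

Definition is_ideal (I : R -> Prop) :=
  [/\ I 0, forall p q, I p -> I q -> I (p + q) & forall a p, I p -> I (a * p)].

Definition graded_piece (I : R -> Prop) t (W : {vspace dhomog n.+1 K t}) :=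
  forall p : dhomog n.+1 K t, p \in W <-> I (mpoly_of_dhomog p).

(** A subspace contained in [I] of maximal dimension exhausts it. *)
Lemma graded_piece_exists (I : R -> Prop) t : is_ideal I ->
  exists W : {vspace dhomog n.+1 K t}, graded_piece I W.
Proof.
move=> [I0 ID IM].
have IZ a p : I p -> I (a *: p) by rewrite -mul_mpolyC; apply: IM.
suff gen d : forall W : {vspace dhomog n.+1 K t},
    (\dim {:dhomog n.+1 K t} - \dim W <= d)%N ->
    (forall q : dhomog n.+1 K t, q \in W -> I (mpoly_of_dhomog q)) ->
    exists W : {vspace dhomog n.+1 K t}, graded_piece I W.
  apply: (gen _ 0%VS (leqnn _)) => p; rewrite memv0 => /eqP->; exact: I0.
elim: d => [|d IHd] W dW WI.
  exists W => p; split=> [/WI //|_].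
  have -> : W = fullv; last exact: memvf.
  by apply/eqP; rewrite eqEdim subvf /= -subn_eq0 -leqn0.
have [h|] := classic (forall p : dhomog n.+1 K t, I (mpoly_of_dhomog p) -> p \in W).
  by exists W => p; split; auto.
move=> /not_all_ex_not[p] /(imply_to_and (I (mpoly_of_dhomog p)) (p \in W))[Ip pW].
apply: (IHd (W + <[p]>)%VS).
  have : (\dim W < \dim (W + <[p]>))%N.
    rewrite (ltn_leqif (dimv_leqif_eq (addvSl _ _))).
    apply/negP => /eqP e; apply: pW; rewrite e.
    exact: (subvP (addvSr W <[p]>%VS) _ (memv_line p)).
  have := dimvS (subvf W); have := dimvS (subvf (W + <[p]>)%VS); lia.
move=> q /memv_addP[w wW [_ /vlineP[a ->] ->]] /=.
by apply: ID; [apply: WI | apply: IZ].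
Qed.

Definition lead_exponents (I : R -> Prop) : pred (seq nat) := fun s =>
  is_lead (fun p => I p /\ p \is (sumn s).-homog) (mnm_of_seq n.+1 s).

Lemma lead_exponents_upclosed (I : R -> Prop) : is_ideal I ->
  upclosed n.+1 (lead_exponents I).
Proof.
move=> [I0 ID IM] s s' sz le /asboolP[p [[Ip hp] p0 lp]]; apply/asboolP.
have sz' : size s' = n.+1 by move: le; rewrite all2E sz => /andP[/eqP].
have lei i : (nth 0%N s i <= nth 0%N s' i)%N.
  have [lti|gei] := ltnP i n.+1; last by rewrite nth_default ?sz.
  elim: s s' i {hp p0 lp sz sz' lti} le => [|a s IHs] [|b s'] [|i] //= /andP[h1 h2] //.
  exact: IHs.
have le' : (mnm_of_seq n.+1 s <= mnm_of_seq n.+1 s')%MM.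
  by apply/mnm_lepP => i; rewrite !mnmE.
pose d := (mnm_of_seq n.+1 s' - mnm_of_seq n.+1 s)%MM.
exists ('X_[d] * p); split.
- split; first exact: IM.
  have -> : sumn s' = (mdeg d + sumn s)%N.
    by rewrite -(mdeg_mnm_of_seq sz') -(mdeg_mnm_of_seq sz) -mdegD submK.
  by apply: dhomogM => //; rewrite dhomogX.
- by rewrite mulf_neq0 ?mpolyX_neq0.
- by rewrite mleadM ?mpolyX_neq0 // mleadXm lp submK.
Qed.

(** Macaulay's theorem on initial ideals: subtract [dim_lead] for [W] from
[dim_lead] for the whole space. *)
Lemma hilbert_gap_count (I : R -> Prop) t (W : {vspace dhomog n.+1 K t}) :
  graded_piece I W ->
  (\dim {:dhomog n.+1 K t})%:Z - (\dim W)%:Z = gap_count n.+1 (lead_exponents I) t.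
Proof.
move=> hW; pose s := map (mnm_of_seq n.+1) (exponents n.+1 t).
have us : uniq s by rewrite map_inj_in_uniq ?exponents_uniq //; apply: mnm_of_seq_inj.
have ms := mem_mnm_exponents t : forall m : 'X_{1..n.+1}, (m \in s) = _.
rewrite (dim_lead fullv us ms) (dim_lead W us ms).
rewrite (@eq_in_count _ _ predT); last first.
  move=> m; rewrite ms => /eqP dm; apply/asboolP; exists 'X_[m].
  rewrite mpolyX_neq0 mleadXm; split=> //.
  have h : ('X_[m] : R) \is t.-homog by rewrite dhomogX; apply/eqP.
  by exists (DHomog h); rewrite ?memvf.
rewrite count_predT size_map /gap_count.
rewrite -(count_predC (lead_exponents I) (exponents n.+1 t)).
rewrite PoszD count_map addrAC -[RHS]add0r; congr (_ + _); apply/eqP; rewrite subr_eq0.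
apply/eqP; congr Posz; apply: eq_in_count => x.
rewrite mem_exponents => /andP[/eqP sz /eqP st] /=.
apply/asboolP/asboolP => [[p [[Ip hp] p0 lp]]|[_ [[w wW ->] p0 lp]]].
  exists p; split=> //; rewrite st in hp; exists (DHomog hp) => //; exact/hW.
exists w; split=> //; split; [exact/hW | rewrite st; exact: valP].
Qed.
End Ideal.

(** * Ideals of codimension two containing a coprime pair *)

Section HomogDivisor.
Variables (K : fieldType) (n : nat).
Implicit Types (p q : {mpoly K[n]}).

(** In the product, the smallest monomials of the factors meet only each other. *)
Lemma mcoeffM_mlast p q : p != 0 -> q != 0 -> (mlast p + mlast q)%MM \in msupp (p * q).
Proof.
move=> p0 q0; rewrite mcoeff_msupp mpolyME raddf_sum /=.
rewrite (bigD1_seq (mlast p, mlast q)) /=; first last.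
- by rewrite allpairs_uniq // => -[? ?] [].
- by rewrite allpairs_f // mlast_supp.
rewrite mcoeffZ mcoeffX eqxx mulr1 big_seq_cond big1 => [|[m1 m2]].
  by rewrite addr0 mulf_neq0 // -mcoeff_msupp mlast_supp.
move=> /andP[/allpairsP[[a b] /= [/mlast_lemc le1 /mlast_lemc le2 [-> ->]]] ne].
rewrite mcoeffZ mcoeffX; case: eqP => [e|_]; last by rewrite mulr0.
case/eqP: ne; move: le1; rewrite le_eqVlt => /orP[/eqP e1|lt1].
  by move: e; rewrite -e1 => /addmI ->.
by have := ltmc_le_add lt1 le2; rewrite e ltxx.
Qed.

(** The lowest and the highest monomials of a product are the products of those of
the factors, so neither factor can have terms of two different degrees. *)
Lemma homog_divisor d p q : p * q != 0 -> p * q \is d.-homog ->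
  exists k l, [/\ d = (k + l)%N, p \is k.-homog & q \is l.-homog].
Proof.
rewrite mulf_eq0 negb_or => /andP[p0 q0] hpq.
have hi : (mdeg (mlead p) + mdeg (mlead q) = d)%N.
  rewrite -mdegD -mleadM //; apply: (dhomog_mf hpq).
  by rewrite mlead_supp ?mulf_neq0.
have lo : (mdeg (mlast p) + mdeg (mlast q) = d)%N.
  by rewrite -mdegD; apply: (dhomog_mf hpq); apply: mcoeffM_mlast.
have between (r : {mpoly K[n]}) m : m \in msupp r ->
    (mdeg (mlast r) <= mdeg m <= mdeg (mlead r))%N.
  by move=> mr; rewrite !lemc_mdeg ?mlast_lemc ?msupp_le_mlead.
have le_p : (mdeg (mlast p) <= mdeg (mlead p))%N.
  by case/andP: (between p _ (mlead_supp p0)).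
have le_q : (mdeg (mlast q) <= mdeg (mlead q))%N.
  by case/andP: (between q _ (mlead_supp q0)).
have hom (r : {mpoly K[n]}) : mdeg (mlast r) = mdeg (mlead r) ->
    r \is (mdeg (mlead r)).-homog.
  by move=> e; apply/dhomogP => m /between; rewrite e -eqn_leq => /eqP.
by exists (mdeg (mlead p)), (mdeg (mlead q)); split; rewrite ?hom //; lia.
Qed.
End HomogDivisor.

Section MulDhomog.
Variables (K : fieldType) (n e : nat) (p : {mpoly K[n.+1]}).
Hypothesis hp : p \is e.-homog.
Variable t : nat.

Definition mul_dhomog (c : dhomog n.+1 K t) : dhomog n.+1 K (t + e) :=
  DHomog (dhomogM (valP c) hp).

Lemma mul_dhomog_is_linear : linear mul_dhomog.
Proof. by move=> a c d; apply: val_inj; rewrite /= mulrDl scalerAl. Qed.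

HB.instance Definition _ :=
  GRing.isLinear.Build K _ _ _ mul_dhomog mul_dhomog_is_linear.
End MulDhomog.

Section CompleteIntersection.
Variables (K : fieldType) (n e : nat) (p q : {mpoly K[n.+1]}).
Hypotheses (hp : p \is e.-homog) (hq : q \is e.-homog).
Hypothesis q0 : q != 0.
Hypothesis coprime_pq : forall a b, a * p = b * q -> divides q a.

Local Notation V t := (dhomog n.+1 K t).

Section Maps.
Variable s : nat.
Definition comb (ab : V (s + e) * V (s + e)) : V (s + e + e) :=
  mul_dhomog hp ab.1 + mul_dhomog hq ab.2.
Lemma comb_is_linear : linear comb.
Proof.
move=> a [b c] [b' c']; rewrite /comb /= !linearP /= scalerDr !addrA; congr (_ + _).
by rewrite addrAC.
Qed.
HB.instance Definition _ := GRing.isLinear.Build K _ _ _ comb comb_is_linear.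

(** The syzygies of the pair that hold for trivial reasons. *)
Definition koszul (c : V s) : V (s + e) * V (s + e) :=
  (mul_dhomog hq c, - mul_dhomog hp c).
Lemma koszul_is_linear : linear koszul.
Proof.
move=> a b c; rewrite /koszul (linearP (@mul_dhomog K n e q hq s)).
by rewrite (linearP (@mul_dhomog K n e p hp s)) opprD -scalerN.
Qed.
HB.instance Definition _ := GRing.isLinear.Build K _ _ _ koszul koszul_is_linear.
End Maps.

(** A relation [a p + b q = 0] between coprime elements is a multiple of the
trivial one, so the kernel of [comb] is no larger than the space of multipliers;
conclude by rank and nullity. *)
Lemma dim_complete_intersection s (W : {vspace V (s + e + e)}) :
  (forall a b : V (s + e), comb (a, b) \in W) ->
  (2 * \dim {: V (s + e)} <= \dim W + \dim {: V s})%N.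
Proof.
move=> sub; have := limg_ker_dim (linfun (@comb s)) fullv.
rewrite capfv dimvf /dim /= => dimE.
have le1 : (\dim (limg (linfun (@comb s))) <= \dim W)%N.
  by apply/dimvS/subvP => _ /memv_imgP[[a b] _ ->]; rewrite lfunE; apply: sub.
have le2 : (\dim (lker (linfun (@comb s))) <= \dim {: V s})%N.
  apply: leq_trans (_ : \dim (limg (linfun (@koszul s))) <= _)%N; last first.
    by rewrite -(limg_ker_dim (linfun (@koszul s)) fullv) leq_addl.
  apply/dimvS/subvP => -[a b]; rewrite memv_ker lfunE /= => /eqP/(congr1 val) /= ab.
  have [c aE] : divides q (val a).
    apply: (@coprime_pq _ (- val b)); apply/eqP.
    by rewrite mulNr -subr_eq0 opprK; apply/eqP.
  have bE : val b = - (c * p).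
    apply: (mulIf q0); apply/eqP; rewrite -subr_eq0 mulNr opprK; apply/eqP.
    by rewrite -ab aE mulrAC addrC.
  have hc : c \is s.-homog.
    have [c0|c0] := eqVneq c 0; first by rewrite c0 dhomog0.
    have cq0 : c * q != 0 by rewrite mulf_neq0.
    have [|k [l [sE hck hql]]] := homog_divisor cq0 (d := (s + e)%N).
      by rewrite -aE; apply: valP.
    have -> : s = k; last by [].
    by have := dhomog_uniq q0 hq hql; lia.
  have -> : (a, b) = linfun (@koszul s) (DHomog hc).
    rewrite lfunE /=; congr (_, _); apply: val_inj; [exact: aE | exact: bE].
  exact: memv_img (memvf _).
move: dimE le1 le2; rewrite [X in _ = X]addnn -mul2n !dimvf /dim /=; lia.
Qed.
End CompleteIntersection.

(** The second difference, with step [e], of the Hilbert polynomial of the projective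
space: it is the Hilbert function of a complete intersection of two surfaces of
degree [e]. *)
Lemma double_step_binomial e s : 'C(s + e + e + 3, s + e + e)%:Z + 'C(s + 3, s)%:Z
  - 2 * 'C(s + e + 3, s + e)%:Z = e%:Z ^+ 2 * (s + e + 2)%:Z.
Proof.
have bin3 t : 6 * 'C(t + 3, t)%:Z = (t%:Z + 3) * (t%:Z + 2) * (t%:Z + 1).
  rewrite -[t in 'C(_, t)](addnK 3) bin_sub ?leq_addl //.
  have := bin_ffact (t + 3) 3; rewrite !ffactnS ffactn0 => h.
  have {h} : ('C(t + 3, 3) * 6 = (t + 3) * ((t + 2) * (t + 1)))%N by rewrite h /=; lia.
  by move/(congr1 Posz); rewrite !PoszM !PoszD; lia.
have h1 := bin3 (s + e + e)%N; have h2 := bin3 s; have h3 := bin3 (s + e)%N.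
move: h1 h2 h3; rewrite !PoszD; nia.
Qed.

Section CodimensionTwo.
Variables (K : fieldType) (I : {mpoly K[4]} -> Prop) (e : nat) (p q : {mpoly K[4]}).
Hypotheses (idI : is_ideal I) (Ip : I p) (Iq : I q).
Hypotheses (hp : p \is e.-homog) (hq : q \is e.-homog) (q0 : q != 0).
Hypothesis coprime_pq : forall a b, a * p = b * q -> divides q a.

Lemma codim_bound s (W : {vspace dhomog 4 K (s + e + e)}) : graded_piece I W ->
  (\dim {:dhomog 4 K (s + e + e)})%:Z - (\dim W)%:Z <= e%:Z ^+ 2 * (s + e + 2)%:Z.
Proof.
move=> hW; rewrite -double_step_binomial.
have := dim_complete_intersection (hp := hp) (hq := hq) q0 coprime_pq (W := W).
rewrite !dimvf /dim /= => h.
have /h : forall a b : dhomog 4 K (s + e), comb hp hq (a, b) \in W; last by lia.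
move=> a b; apply/hW; have [_ ID IM] := idI.
by apply: ID; apply: IM.
Qed.

Lemma gap_count_bound :
  eventually (fun t =>
    gap_count 4 (lead_exponents I) t <= (e ^ 2)%:Z * t%:Z + (2 * e ^ 2)%:Z).
Proof.
exists (e + e)%N => t let_; rewrite -(subnK let_) addnA.
have [W hW] := graded_piece_exists (t - (e + e) + e + e) idI.
rewrite -(hilbert_gap_count hW).
apply: le_trans (codim_bound hW) _; nia.
Qed.

Lemma hilbert_linear : exists b c, eventually (fun t =>
  forall W : {vspace dhomog 4 K t}, graded_piece I W ->
  (\dim {:dhomog 4 K t})%:Z - (\dim W)%:Z = b * t%:Z + c).
Proof.
have [//|b [c [t0 h]]] := eventually_linear
  (gap_count_poly (lead_exponents_upclosed idI)) _ gap_count_bound.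
by exists b, c, t0 => t /h <- W; apply: hilbert_gap_count.
Qed.

Lemma hilbert_slope_bounds b c : eventually (fun t =>
  exists2 W : {vspace dhomog 4 K t}, graded_piece I W &
  (\dim {:dhomog 4 K t})%:Z - (\dim W)%:Z = b * t%:Z + c) -> 0 <= b <= (e ^ 2)%:Z.
Proof.
move=> h; apply: (@slope_bounds _ c _ (2 * e ^ 2)%:Z).
apply: eventually_impl (eventually_and h gap_count_bound) => t [[W hW <-]].
by rewrite (hilbert_gap_count hW) => ->.
Qed.
End CodimensionTwo.

Section CurveDegree.
Variables (K : closedFieldType) (I : {mpoly K[4]} -> Prop).
Variables (e : nat) (p q : {mpoly K[4]}).
Hypotheses (idI : is_ideal I) (Ip : I p) (Iq : I q).
Hypotheses (hp : p \is e.-homog) (hq : q \is e.-homog) (q0 : q != 0).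
Hypothesis coprime_pq : forall a b, a * p = b * q -> divides q a.

Lemma curve_degree_exists : exists b, curve_degree I b.
Proof.
have [b [c [t0 h]]] := hilbert_linear idI Ip Iq hp hq q0 coprime_pq.
exists b, c, t0 => t lt; have [W hW] := graded_piece_exists t idI.
by exists W; split; [exact: hW | exact: h].
Qed.

Lemma curve_degree_bounds b : curve_degree I b -> 0 <= b <= (e ^ 2)%:Z.
Proof.
move=> [c [t0 h]].
apply: (hilbert_slope_bounds idI Ip Iq hp hq q0 coprime_pq (c := c)).
by exists t0 => t /h[W [hW dW]]; exists W.
Qed.
End CurveDegree.

(** * The bivector dual to a pair of covectors *)

Section Star.
Variable R : comNzRingType.
Implicit Types (a b u v : nat -> R).

Definition pairing a v := a 0%N * v 0%N + a 1%N * v 1%N + a 2%N * v 2%N + a 3%N * v 3%N.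

Definition minor a b (k l : nat) := a k * b l - a l * b k.

(** The coordinates of the bivector dual to [a /\ b] under a volume form: the signed
minors on the complementary indices.  Vectors are functions on [nat], used at 0, 1, 2
and 3, so that identities between coordinates can be checked case by case. *)
Definition star a b (i j : nat) : R :=
  match i, j with
  | 0, 1 => minor a b 2 3 | 0, 2 => - minor a b 1 3 | 0, 3 => minor a b 1 2
  | 1, 2 => minor a b 0 3 | 1, 3 => - minor a b 0 2 | 2, 3 => minor a b 0 1
  | 1, 0 => - minor a b 2 3 | 2, 0 => minor a b 1 3 | 3, 0 => - minor a b 1 2
  | 2, 1 => - minor a b 0 3 | 3, 1 => minor a b 0 2 | 3, 2 => - minor a b 0 1
  | _, _ => 0
  end.

(** Expansion of a determinant with a repeated row. *)
Lemma pairing_star a b k :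
  pairing a (star a b ^~ k) = 0 /\ pairing b (star a b ^~ k) = 0.
Proof. by case: k => [|[|[|[|k]]]]; rewrite /pairing /star /minor; split; ring. Qed.

(** The Cauchy-Binet formula for a 2x4 matrix times a 4x2 matrix. *)
Lemma pairing_minor a b u w :
  pairing a u * pairing b w - pairing b u * pairing a w =
  star a b 0 1 * minor u w 2 3 - star a b 0 2 * minor u w 1 3
  + star a b 0 3 * minor u w 1 2 + star a b 1 2 * minor u w 0 3
  - star a b 1 3 * minor u w 0 2 + star a b 2 3 * minor u w 0 1.
Proof. rewrite /pairing /star /minor; ring. Qed.

(** Coordinates of the equality [star a b /\ v = 0].  This trivector is dual to the
contraction of [a /\ b] with [v], which is [a(v) b - b(v) a]. *)
Lemma star_wedge a b v i j k : pairing a v = 0 -> pairing b v = 0 ->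
  (i < 4)%N -> (j < 4)%N -> (k < 4)%N ->
  v k * star a b i j = star a b i k * v j - star a b j k * v i.
Proof.
move=> av bv i4 j4 k4.
suff [c [l e]] : exists (c : R) l,
    v k * star a b i j - (star a b i k * v j - star a b j k * v i)
    = c * (pairing a v * b l - pairing b v * a l).
  by apply/eqP; rewrite -subr_eq0 e av bv !mul0r subrr mulr0.
(* For distinct [i], [j], [k] this is the fourth index, and the sign is that of a
   permutation; for other indices the left-hand side vanishes. *)
pose l := (6 - i - j - k)%N.
suff [e|[e|e]] :
    let x := v k * star a b i j - (star a b i k * v j - star a b j k * v i) in
    let y := pairing a v * b l - pairing b v * a l in
    x = 0 * y \/ x = 1 * y \/ x = (-1) * y.
- by exists 0, l.
- by exists 1, l.
- by exists (-1), l.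
rewrite {}/l {av bv}.
move: i j k i4 j4 k4 => [|[|[|[|//]]]] [|[|[|[|//]]]] [|[|[|[|//]]]] _ _ _;
  rewrite /pairing /star /minor ?subn0 /=;
  first [left; ring | right; left; ring | right; right; ring].
Qed.
End Star.

(** The common kernel of [a] and [b] is a plane, so the wedge product of two of its
vectors is proportional to the bivector dual to [a /\ b]; this is written without
denominators, and follows from four instances of [star_wedge]. *)
Lemma star_wedge2 (R : comNzRingType) (a b u v : nat -> R) i j k l :
  pairing a u = 0 -> pairing b u = 0 -> pairing a v = 0 -> pairing b v = 0 ->
  (i < 4)%N -> (j < 4)%N -> (k < 4)%N -> (l < 4)%N ->
  star a b k l * minor u v i j = minor u v k l * star a b i j.
Proof.
move=> au bu av bv i4 j4 k4 l4; rewrite /minor.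
have h1 := star_wedge av bv k4 l4 j4; have h2 := star_wedge av bv k4 l4 i4.
have h3 := star_wedge au bu i4 j4 k4; have h4 := star_wedge au bu i4 j4 l4.
have anti x y : star a b x y = - star a b y x.
  by move: x y => [|[|[|[|x]]]] [|[|[|[|y]]]]; rewrite /star ?opprK ?oppr0.
transitivity (u i * (v j * star a b k l) - u j * (v i * star a b k l)); first by ring.
rewrite h1 h2.
transitivity (v l * (u k * star a b i j) - v k * (u l * star a b i j)); last by ring.
rewrite h3 h4 (anti k) (anti l) (anti k) (anti l); ring.
Qed.

(** * Coprime combinations and homogeneous polynomials *)

Section Avoid.
Variable R : idomainType.
Hypothesis natu : forall n : nat, (0 < n)%N -> (n%:R : R) \is a GRing.unit.

(** Two integers [t] for which [r] divides [x + t y] give, by subtraction, that it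
divides both [x] and [y]; so at most one [t] is excluded. *)
Lemma eventually_not_divides (r x y : R) : ~ (divides r x /\ divides r y) ->
  eventually (fun t => ~ divides r (x + t%:R * y)).
Proof.
move=> nxy.
have [[t1 d1]|nex] := classic (exists t1 : nat, divides r (x + t1%:R * y)); last first.
  by exists 0%N => t _ dt; apply: nex; exists t.
exists t1.+1 => t lt d; apply: nxy.
have dy : divides r y.
  have tu := natu (n := (t - t1)%N); rewrite subn_gt0 in tu.
  have -> : y = (t - t1)%:R^-1 * ((x + t%:R * y) - (x + t1%:R * y)).
    rewrite addrAC opprD addrA subrr add0r addrC -mulrBl -natrB; last exact: ltnW.
    by rewrite mulKr ?tu.
  by apply: divides_mull; apply: divides_add => //; apply: divides_opp.
split=> //; rewrite -(addrK (t%:R * y) x); apply: divides_add => //.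
by apply: divides_opp; apply: divides_mull.
Qed.

(** The primes are treated one after the other: for a new prime [r], add a multiple of
an entry that [r] does not divide, with a factor that is large enough to spoil
nothing. *)
Lemma avoid_primes n (nu : 'I_n -> R) (ps : seq R) :
  (forall r, prime_elt r -> exists i, ~ divides r (nu i)) ->
  {in ps, forall r, prime_elt r} ->
  exists lam : 'I_n -> nat, {in ps, forall r, ~ divides r (\sum_i (lam i)%:R * nu i)}.
Proof.
move=> prim; elim: ps => [|r ps IHps] pps; first by exists (fun=> 0%N).
have [|lam hlam] := IHps; first by move=> x xs; apply: pps; rewrite in_cons xs orbT.
have [k rk] := prim r (pps r (mem_head _ _)).
have [T hT] : eventually (fun t => {in r :: ps, forall x,
    ~ divides x (\sum_i (lam i)%:R * nu i + t%:R * nu k)}).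
  have : {in r :: ps, forall x,
      ~ (divides x (\sum_i (lam i)%:R * nu i) /\ divides x (nu k))}.
    by move=> x; rewrite in_cons => /orP[/eqP-> [_ /rk]|/hlam h [/h]].
  elim: (r :: ps) => [|x s IHs] h; first by exists 0%N.
  have h1 := eventually_not_divides (h x (mem_head _ _)).
  have h2 : {in s, forall x,
      ~ (divides x (\sum_i (lam i)%:R * nu i) /\ divides x (nu k))}.
    by move=> y ys; apply: h; rewrite in_cons ys orbT.
  apply: eventually_impl (eventually_and h1 (IHs h2)) => t [g1 g2] y.
  by rewrite in_cons => /orP[/eqP->|/g2].
exists (fun i => (lam i + (i == k) * T)%N) => x xs.
rewrite (eq_bigr
  (fun i => (lam i)%:R * nu i + (i == k)%:R * (T%:R * nu i))); last first.
  by move=> i _; rewrite natrD natrM mulrDl mulrA.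
rewrite big_split /= [X in _ + X](bigD1 k) //= eqxx mul1r [X in _ + (_ + X)]big1 ?addr0.
  exact: hT.
by move=> i /negPf->; rewrite mul0r.
Qed.

(** The primes of [q] cancel successively against [a]. *)
Lemma coprime_of_primes (u p : R) (ps : seq R) : u \is a GRing.unit ->
  {in ps, forall r, prime_elt r} -> {in ps, forall r, ~ divides r p} ->
  forall a b, a * p = b * (u * \prod_(r <- ps) r) -> divides (u * \prod_(r <- ps) r) a.
Proof.
move=> uu; elim: ps => [|r ps IHps] pps nd a b.
  by move=> _; rewrite big_nil mulr1; exists (a * u^-1); rewrite divrK.
rewrite big_cons => abE; have pr := pps r (mem_head _ _); have [r0 _ hr] := pr.
have [|[c aE]|/(nd r (mem_head _ _))//] := hr a p.
  by rewrite abE; exists (b * (u * \prod_(j <- ps) j)); ring.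
have [|||d cE] := IHps _ _ c b.
- by move=> x xs; apply: pps; rewrite in_cons xs orbT.
- by move=> x xs; apply: nd; rewrite in_cons xs orbT.
- apply: (mulIf r0); rewrite mulrAC -aE abE; ring.
by exists d; rewrite aE cE; ring.
Qed.
End Avoid.

Section Homog.
Variables (K : fieldType) (n : nat).
Implicit Types (p q r : {mpoly K[n]}).

Lemma homog_mderiv p d i : p \is d.+1.-homog -> mderiv i p \is d.-homog.
Proof.
move=> hp; apply/dhomogP => m; rewrite mcoeff_msupp mcoeff_deriv => h.
have /(dhomog_mf hp) : (m + U_(i))%MM \in msupp p.
  by rewrite mcoeff_msupp; apply: contraNneq h => ->; rewrite mul0rn.
by rewrite /= mdegD mdeg1 addn1 => -[].
Qed.

Lemma homog_var (i : 'I_n) : ('X_i : {mpoly K[n]}) \is 1.-homog.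
Proof. by rewrite dhomogX; apply/eqP/mdeg1. Qed.

Lemma homog0_const p : p \is 0.-homog -> p = (p@_0)%:MP.
Proof.
move=> hp; apply/mpolyP => m; rewrite mcoeffC.
have [<-|m0] := eqVneq 0%MM m; first by rewrite mulr1.
by rewrite mulr0; apply: (dhomog_nemf_coeff hp); rewrite mdeg_eq0 eq_sym.
Qed.

Lemma homog0_unit p : p != 0 -> p \is 0.-homog -> p \is a GRing.unit.
Proof.
move=> p0 /homog0_const pE; rewrite pE; apply: rmorph_unit; rewrite unitfE.
by apply: contraNneq p0 => h; rewrite pE h.
Qed.

Lemma divides_pihomog r e p k : r \is e.-homog ->
  divides r p -> divides r (pihomog mdeg k p).
Proof.
move=> hr [c ->]; rewrite (pihomog_partitionE (leqnn (mmeasure mdeg c))).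
rewrite mulr_suml raddf_sum; apply: divides_sum => d _ /=.
have h : pihomog mdeg d c * r \is (d + e).-homog.
  by apply: dhomogM => //; apply: pihomogP.
have [<-|ne] := eqVneq (d + e)%N k.
  by rewrite pihomog_dE //; apply: divides_mull; apply: divides_refl.
by rewrite (pihomog_ne0 ne h); apply: divides0.
Qed.
End Homog.

(** * The syzygies of a normal sequence and the Bourbaki map *)

Section PrimePoints.
Variable K : closedFieldType.
Local Notation R := {mpoly K[4]}.

Definition principal (r : R) : {pred R} := fun p => asbool (divides r p).

Lemma principalP r p : reflect (divides r p) (p \in principal r).
Proof. exact: asboolP. Qed.

(** A homogeneous prime dividing a variable is that variable up to a constant. *)
Lemma prime_not_divides_all_vars (r : R) e : prime_elt r -> r \is e.-homog ->
  exists i : 'I_4, ~ divides r 'X_i.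
Proof.
move=> pr hr; apply: NNPP => nex.
have dv i : divides r 'X_i by apply: NNPP => h; apply: nex; exists i.
have [r0 ru _] := pr.
have con (i : 'I_4) (c : R) : 'X_i = c * r -> exists2 c0 : K, c0 != 0 & c = c0%:MP.
  move=> cE; have x0 : c * r != 0 by rewrite -cE mpolyX_neq0.
  have [|k [l [kl hc hl]]] := homog_divisor (d := 1) x0.
    by rewrite -cE homog_var.
  have k0 : k = 0%N.
    case: l kl hl => [|l] kl hl; last by lia.
    by case/negP: ru; apply: homog0_unit hl.
  rewrite k0 in hc; have cC := homog0_const hc.
  exists c@_0 => //; apply: contraNneq x0 => h.
  by rewrite cC h mpolyC0 mul0r.
have [c cE] := dv ord0; have [d dE] := dv ord_max.
have [c0 c00 cC] := con _ _ cE; have [d0 d00 dC] := con _ _ dE.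
have : d * 'X_ord0 = c * 'X_ord_max by rewrite cE dE; ring.
rewrite cC dC !mul_mpolyC => /(congr1 (mcoeff U_(ord0))).
rewrite !mcoeffZ !mcoeffXU eqxx mulr1 /= mulr0 => h.
by rewrite h eqxx in d00.
Qed.

Lemma principal_point (r : R) e : prime_elt r -> r \is e.-homog ->
  is_point (principal r).
Proof.
move=> pr hr; have [r0 ru hp] := pr; split.
- split; first by apply/principalP; apply: divides0.
    by apply/principalP; apply: prime_not_divides1.
  move=> a u v /principalP du /principalP dv; apply/principalP.
  by apply: divides_add => //; apply: divides_mull.
- move=> u v /principalP /hp[h|h]; apply/orP; [left|right]; exact/principalP.
- move=> p k /principalP d; apply/principalP; exact: divides_pihomog hr d.
have [i di] := prime_not_divides_all_vars pr hr.
by exists i; apply/principalP.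
Qed.

(** Krull's principal ideal theorem in a factorial ring: a prime ideal properly
contained in a principal one does not contain its generator [r], so with [c r] it
contains [c], and descent on the degree shows that it is zero. *)
Lemma sub_principal_zero (r : R) (P : {pred R}) : prime_elt r -> is_point P ->
  {subset P <= principal r} -> (exists2 p, p \in principal r & p \notin P) ->
  forall p, p \in P -> p = 0.
Proof.
move=> pr [[P0 _ Padd] Ppr _ _] sub [q /principalP[c qE] qP] p.
have rP : r \notin P.
  apply: contraNN qP => rP; rewrite qE -[_ * _]addr0; exact: Padd.
have [r0 ru _] := pr; have szr : (1 < msize r)%N.
  rewrite ltn_neqAle lt0n msize_poly_eq0 r0 andbT; apply/negP => /eqP h.
  have rC := msize1_polyC (eq_leq (esym h)); case/negP: ru; rewrite rC.
  by apply: rmorph_unit; rewrite unitfE; apply: contraNneq r0 => h'; rewrite rC h'.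
have [m] := ubnP (msize p); elim: m p => // m IHm p; rewrite ltnS => szp pP.
have [//|p0] := eqVneq p 0; have /principalP[d dE] := sub p pP.
have d0 : d != 0 by apply: contraNneq p0 => h; rewrite dE h mul0r.
have dP : d \in P by move: pP; rewrite dE => /Ppr /orP[//|h]; rewrite h in rP.
suff h : d = 0 by rewrite h eqxx in d0.
apply: IHm => //; apply: leq_trans szp; rewrite dE msizeM //.
by case: (msize r) szr => [|[|k]] // _; rewrite !addnS /= ltnS leq_addr.
Qed.

Lemma principal_codim (r : R) : prime_elt r -> ~ codim_ge 2 (principal r).
Proof.
move=> pr /= [P [Ppt sub prop [Q [[[Q0 _ _] _ _ _] _ [p pP pQ] _]]]].
by rewrite (sub_principal_zero pr Ppt sub prop pP) Q0 in pQ.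
Qed.

Lemma zero_point : is_point (pred1 (0 : R)).
Proof.
split.
- split; rewrite ?inE ?oner_eq0 //.
  by move=> a u v /eqP-> /eqP->; rewrite mulr0 addr0 inE.
- by move=> u v; rewrite !inE mulf_eq0.
- by move=> p k; rewrite !inE => /eqP->; rewrite pihomog0.
by exists ord0; rewrite inE mpolyX_neq0.
Qed.

Lemma zero_codim : ~ codim_ge 2 (pred1 (0 : R)).
Proof.
move=> /= [P [[[P0 _ _] _ _ _] _ [p]]]; rewrite inE => /eqP->.
by rewrite P0.
Qed.
End PrimePoints.

Section Sequence.
Variables (K : closedFieldType) (s : sequence K).
Local Notation R := {mpoly K[4]}.
Implicit Types (u v nu : 'cV[R]_4).

Definition grad_f (k : nat) : R := mderiv (inord k) (seq_f s).
Definition grad_g (k : nat) : R := mderiv (inord k) (seq_g s).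
Definition coords u (k : nat) : R := u (inord k) 0.
Local Notation N := (star grad_f grad_g).
Local Notation d := (df s + dg s)%N.

Lemma jacobian_pairing u : jacobian s *m u =
  \col_(i < 2)
    (if i == 0 then pairing grad_f (coords u) else pairing grad_g (coords u)).
Proof.
apply/matrixP => i j; rewrite !mxE (ord1 j) !big_ord_recl big_ord0 addr0.
rewrite /pairing /coords /grad_f /grad_g !mxE !addrA.
by case: (i == 0); congr (_ * _ + _ * _ + _ * _ + _ * _); congr mderiv || congr (u _ _);
   apply: val_inj; rewrite /= inordK.
Qed.

Lemma syzP u : syz s u <->
  pairing grad_f (coords u) = 0 /\ pairing grad_g (coords u) = 0.
Proof.
rewrite /syz jacobian_pairing; split=> [h|[-> ->]].
  split; first by have := congr1 (fun M : 'cV_2 => M 0 0) h; rewrite !mxE.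
  by have := congr1 (fun M : 'cV_2 => M 1 0) h; rewrite !mxE.
by apply/matrixP => i j; rewrite !mxE if_same.
Qed.

Lemma homog_grad k : grad_f k \is (df s).-homog /\ grad_g k \is (dg s).-homog.
Proof. by split; apply: homog_mderiv; [apply: seq_f_homog | apply: seq_g_homog]. Qed.

Lemma homog_star i j : N i j \is d.-homog.
Proof.
have hm k l : minor grad_f grad_g k l \is d.-homog.
  by rewrite /minor rpredB // dhomogM //; case: (homog_grad k); case: (homog_grad l).
by move: i j => [|[|[|[|i]]]] [|[|[|[|j]]]]; rewrite /star ?rpredN ?hm ?dhomog0.
Qed.

Definition star_col (k : nat) : 'cV[R]_4 := \col_(i < 4) N i k.

Lemma coords_col (w : nat -> R) k : (k < 4)%N -> coords (\col_(i < 4) w i) k = w k.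
Proof. by move=> k4; rewrite /coords mxE inordK. Qed.

Lemma coordsE u (i : 'I_4) : u i 0 = coords u i.
Proof. by rewrite /coords inord_val. Qed.

Lemma pairing_col a (w : nat -> R) :
  pairing a (coords (\col_(i < 4) w i)) = pairing a w.
Proof. by rewrite /pairing !coords_col. Qed.

Lemma syz_star k : syz s (star_col k).
Proof. by apply/syzP; rewrite !(pairing_col _ (N ^~ k)); apply: pairing_star. Qed.

Lemma H0_T_star k : H0_T s d%:Z (star_col k).
Proof. by split; [apply: syz_star | move=> i; rewrite mxE; apply: homog_star]. Qed.

(** If the cokernel vanished at the prime [P], the Jacobian matrix times some 4x2 matrix
would be diagonal with entries outside [P]; by the Cauchy-Binet formula its
determinant is a combination of the minors. *)
Lemma minors_in_supp (P : {pred R}) : is_point P ->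
  (forall i j, (i < 4)%N -> (j < 4)%N -> N i j \in P) -> in_supp_Q s P.
Proof.
move=> [[P0 P1 Padd] Ppr _ [x0 x0P]] NP; apply: NNPP => nsupp.
pose x : R := 'X_x0.
have hx k : x ^+ k \is k.-homog.
  by have := dhomogMn k (_ : x \is 1.-homog); rewrite mul1n; apply; apply: homog_var.
have xP k : x ^+ k \notin P.
  elim: k => [|k IHk]; first by rewrite expr0.
  by rewrite exprS; apply/negP => /Ppr /orP[h|h]; [rewrite h in x0P|rewrite h in IHk].
have kill (a b : R) : a \is (0 + df s)%N.-homog -> b \is (0 + dg s)%N.-homog ->
    exists (v : R) (u : 'cV[R]_4), [/\ v \notin P, pairing grad_f (coords u) = v * a
      & pairing grad_g (coords u) = v * b].
  move=> ha hb; apply: NNPP => nex; apply: nsupp; exists 0%N, 1, a, b; split=> //.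
    exact: dhomog1.
  move=> l v hv vP [u ju]; apply: nex; exists v, u; split=> //.
    have := congr1 (fun M : 'cV_2 => M 0 0) ju; by rewrite jacobian_pairing !mxE.
  have := congr1 (fun M : 'cV_2 => M 1 0) ju; by rewrite jacobian_pairing !mxE.
have [v [u [vP fu gu]]] := kill (x ^+ df s) 0 (hx _) (dhomog0 _ _ _).
have [w [u' [wP fu' gu']]] := kill 0 (x ^+ dg s) (dhomog0 _ _ _) (hx _).
have := pairing_minor grad_f grad_g (coords u) (coords u').
rewrite fu gu' gu fu' !mulr0 subr0 => e.
have mem r y : r \in P -> r * y \in P.
  by move=> rP; rewrite mulrC -[_ * _]addr0; apply: Padd.
have add y z : y \in P -> z \in P -> y + z \in P.
  by move=> yP zP; rewrite -[y]mul1r; apply: Padd.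
have sub y z : y \in P -> z \in P -> y - z \in P.
  by move=> yP zP; apply: add => //; rewrite -mulrN1; apply: mem.
have : v * x ^+ df s * (w * x ^+ dg s) \in P.
  rewrite e; apply: (add _ _ (sub _ _ (add _ _ (add _ _ (sub _ _ _ _) _) _) _) _);
    by apply: mem; apply: NP.
move=> /Ppr /orP[] /Ppr /orP[h|h].
- by rewrite h in vP.
- by have := xP (df s); rewrite h.
- by rewrite h in wP.
- by have := xP (dg s); rewrite h.
Qed.

Hypothesis normal_s : normal_seq s.

(** Otherwise the generic point would be in the support of the cokernel. *)
Lemma star_nonzero : exists i j : 'I_4, N i j != 0.
Proof.
apply: NNPP => nex; apply: (@zero_codim K); apply: normal_s; first exact: zero_point.
apply: minors_in_supp => [|i j i4 j4]; first exact: zero_point.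
rewrite inE; apply/negPn/negP => h; apply: nex.
by exists (Ordinal i4), (Ordinal j4).
Qed.

Lemma star_primitive (r : R) : prime_elt r ->
  exists ij : 'I_4 * 'I_4, ~ divides r (N ij.1 ij.2).
Proof.
move=> pr; apply: NNPP => nex.
have dN i j : (i < 4)%N -> (j < 4)%N -> divides r (N i j).
  by move=> i4 j4; apply: NNPP => h; apply: nex; exists (Ordinal i4, Ordinal j4).
have [i [j Nij]] := star_nonzero; have [c cE] := dN i j (ltn_ord i) (ltn_ord j).
have [||k [l [_ _ hr]]] := homog_divisor (p := c) (q := r) (d := d).
- by rewrite -cE.
- by rewrite -cE homog_star.
have pt := principal_point pr hr.
apply: (principal_codim pr); apply: normal_s => //; apply: minors_in_supp => //.
by move=> i' j' i4 j4; apply/principalP; apply: dN.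
Qed.

Lemma indeg_spec : is_indeg s (indeg s).
Proof.
apply: epsilon_spec.
pose P (n : nat) := asbool (exists2 u, H0_T s n%:Z u & u != 0).
have exP : exists n, P n.
  exists d; apply/asboolP; have [i [j Nij]] := star_nonzero.
  exists (star_col j); first exact: H0_T_star.
  by apply: contraNneq Nij => /matrixP/(_ i 0); rewrite !mxE => ->.
case: (ex_minnP exP) => n /asboolP[u hu u0] least.
exists n%:Z; split; first by exists u.
move=> [l|l] v hv v0.
  by rewrite lez_nat; apply: least; apply/asboolP; exists v.
case: hv => _ hv; case/eqP: v0; apply/matrixP => i j.
by rewrite (ord1 j) hv mxE.
Qed.

Section Minimal.
Variables (n : nat) (nu : 'cV[R]_4).
Hypotheses (indegE : indeg s = n%:Z) (nuT : H0_T s n%:Z nu) (nu0 : nu != 0).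

Lemma syzygy_entry_nonzero : exists i : 'I_4, nu i 0 != 0.
Proof.
apply: NNPP => nex; case/eqP: nu0; apply/matrixP => i j; rewrite (ord1 j) mxE.
by apply/eqP/negPn/negP => h; apply: nex; exists i.
Qed.

(** Dividing by a common prime would give a syzygy of smaller degree. *)
Lemma minimal_syzygy_primitive (r : R) : prime_elt r ->
  exists i : 'I_4, ~ divides r (nu i 0).
Proof.
move=> pr; apply: NNPP => nex; have [r0 ru _] := pr.
have dn i : exists c, nu i 0 = c * r.
  by apply: NNPP => h; apply: nex; exists i.
have [w wE] := fin_all_exists dn.
have [i0 nui0] := syzygy_entry_nonzero; have [/syzP[fnu gnu] hnu] := nuT.
have [||k [l [nE _ hl]]] := homog_divisor (p := w i0) (q := r) (d := n).
- by rewrite -wE.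
- by rewrite -wE; apply: hnu.
have l0 : (0 < l)%N.
  rewrite lt0n; apply: contraNneq ru => l0; rewrite l0 in hl; exact: homog0_unit hl.
pose u : 'cV[R]_4 := \col_i w i.
have uE i : coords nu i = coords u i * r by rewrite /coords wE mxE.
have hu : H0_T s k%:Z u.
  split.
    apply/syzP; split; apply: (mulIf r0); rewrite mul0r; [rewrite -fnu|rewrite -gnu];
    rewrite /pairing !uE; ring.
  move=> i; rewrite mxE /=; have [->|w0] := eqVneq (w i) 0; first exact: dhomog0.
  have [||k' [l' [nE' hk hl']]] := homog_divisor (p := w i) (q := r) (d := n).
  - by rewrite mulf_neq0.
  - by rewrite -wE; apply: hnu.
  have ll := dhomog_uniq r0 hl hl'.
  by have -> : k = k' by lia.
have u0 : u != 0.
  apply: contraNneq nui0 => /matrixP/(_ i0 0); rewrite !mxE => h.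
  by rewrite wE h mul0r.
have [_ /(_ _ _ hu u0)] := indeg_spec; rewrite indegE lez_nat; lia.
Qed.

(** The proportionality of [star_wedge2], in which the denominator is removed because
the minors have no common prime. *)
Lemma wedge_multiple u : syz s u ->
  exists a, forall i j : 'I_4, minor (coords u) (coords nu) i j = a * N i j.
Proof.
move=> /syzP[fu gu]; have [/syzP[fnu gnu] _] := nuT.
have [k [l Nkl]] := star_nonzero.
have [a aE] := proportional_primitive
  (om := fun ij : 'I_4 * 'I_4 => N ij.1 ij.2)
  (tau := fun ij : 'I_4 * 'I_4 => minor (coords u) (coords nu) ij.1 ij.2)
  (a := minor (coords u) (coords nu) k l)
  (@factorial_mpoly 4 K) Nkl star_primitive
  (fun ij => star_wedge2 fu gu fnu gnu (ltn_ord _) (ltn_ord _) (ltn_ord _) (ltn_ord _)).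
by exists a => i j; apply: (aE (i, j)).
Qed.

Definition bourbaki_map u : R :=
  epsilon (inhabits 0)
    (fun a => forall i j : 'I_4, minor (coords u) (coords nu) i j = a * N i j).

Lemma bourbaki_mapP u : syz s u ->
  forall i j : 'I_4, minor (coords u) (coords nu) i j = bourbaki_map u * N i j.
Proof. by move=> hu; apply: epsilon_spec (wedge_multiple hu). Qed.

Lemma bourbaki_map_unique u a : syz s u ->
  (forall i j : 'I_4, minor (coords u) (coords nu) i j = a * N i j) ->
  bourbaki_map u = a.
Proof.
move=> hu ha; have [k [l Nkl]] := star_nonzero; apply: (mulIf Nkl).
by rewrite -ha bourbaki_mapP.
Qed.

Lemma syz_lin a u v : syz s u -> syz s v -> syz s (a *: u + v).
Proof. by rewrite /syz => hu hv; rewrite mulmxDr -scalemxAr hu hv scaler0 addr0. Qed.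

Lemma wedge_zero_multiple u : syz s u ->
  (forall i j : 'I_4, minor (coords u) (coords nu) i j = 0) -> exists a, u = a *: nu.
Proof.
move=> hu w0; have [k nuk] := syzygy_entry_nonzero.
have [|a aE] := @proportional_primitive _ 'I_4 (fun i => nu i 0) (fun i => u i 0)
  (nu k 0) (u k 0) (@factorial_mpoly 4 K) nuk minimal_syzygy_primitive.
  move=> i; apply/eqP; rewrite -subr_eq0; have := w0 i k.
  by rewrite /minor !coordsE => <-; apply/eqP; ring.
by exists a; apply/matrixP => i j; rewrite (ord1 j) mxE aE.
Qed.

Lemma bourbaki_map_seq : bourbaki_seq s n%:Z nu bourbaki_map.
Proof.
split.
- move=> a u v hu hv; apply: bourbaki_map_unique; first exact: syz_lin.
  move=> i j; rewrite mulrDl -mulrA -!bourbaki_mapP // /minor -!coordsE !mxE; ring.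
- move=> l u [hu hl]; have [_ hnu] := nuT; have [k1 [k2 Nk]] := star_nonzero.
  have [u0|u0] := eqVneq u 0.
    have -> : bourbaki_map u = 0.
      apply: bourbaki_map_unique => // i j.
      by rewrite /minor -!coordsE u0 !mxE !mul0r subrr.
    by case: (l + _ - _) => k //=; apply: dhomog0.
  case: l hl => l hl; last first.
    by case/eqP: u0; apply/matrixP => i j; rewrite (ord1 j) hl mxE.
  have [->|phi0] := eqVneq (bourbaki_map u) 0.
    by case: (_ + _ - _) => k //=; apply: dhomog0.
  have [||a [b [lE ha hb]]] := homog_divisor
    (p := bourbaki_map u) (q := N k1 k2) (d := (l + n)%N).
  + by rewrite mulf_neq0.
  + rewrite -bourbaki_mapP // /minor -!coordsE rpredB //.
      by apply: dhomogM; [apply: hl | apply: hnu].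
    by apply: dhomogM; [apply: hl | apply: hnu].
  have bE := dhomog_uniq Nk hb (homog_star _ _).
  have -> : l%:Z + n%:Z - d%:Z = a%:Z by lia.
  exact: ha.
- move=> u hu; split=> [phi0|[a uE]].
    by apply: wedge_zero_multiple => // i j; rewrite bourbaki_mapP // phi0 mul0r.
  apply: bourbaki_map_unique => // i j.
  rewrite mul0r /minor -!coordsE uE !mxE; ring.
Qed.

(** By [star_wedge], the combination [nu_k N_j - nu_j N_k] is a multiple of [nu], so that
it is killed by [phi]: hence the values [phi(N_j)] are proportional to the entries
[nu_j].  As [nu] is primitive and the degrees agree, the factor is a constant, and it
is not zero because otherwise all [N_j] would be multiples of [nu]. *)
Lemma syzygy_entries_in_bourbaki_ideal phi : bourbaki_seq s n%:Z nu phi ->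
  forall k : 'I_4, bourbaki_ideal s phi (nu k 0).
Proof.
move=> [lin deg ker]; have [/syzP[fnu gnu] hnu] := nuT.
have [k0 nuk0] := syzygy_entry_nonzero.
have syz0 : syz s 0 by apply: mulmx0.
have phi0 : phi 0 = 0.
  by have [_ h] := ker 0 syz0; apply: h; exists 0; rewrite scale0r.
have phiZ a u : syz s u -> phi (a *: u) = a * phi u.
  by move=> hu; rewrite -[a *: u]addr0 lin // phi0 addr0.
have rel (j k : 'I_4) : nu k 0 * phi (star_col j) = nu j 0 * phi (star_col k).
  apply/eqP; rewrite -subr_eq0; apply/eqP.
  have hj := syz_star j; have hk := syz_star k.
  have hk' : syz s ((- nu j 0) *: star_col k).
    by rewrite /syz -scalemxAr hk scaler0.
  transitivity (phi (nu k 0 *: star_col j + (- nu j 0) *: star_col k)).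
    by rewrite lin // phiZ // mulNr.
  apply: (iffRL (ker _ (syz_lin _ hj hk'))).
  exists (- N j k); apply/matrixP => i i0; rewrite (ord1 i0) !mxE !coordsE.
  have h := star_wedge fnu gnu (ltn_ord j) (ltn_ord k) (ltn_ord i).
  have anti x y : N x y = - N y x.
    by move: x y => [|[|[|[|x]]]] [|[|[|[|y]]]]; rewrite /star ?opprK ?oppr0.
  transitivity (- (coords nu i * N j k)); last by ring.
  rewrite h (anti j i) (anti k i); ring.
have [|a aE] := @proportional_primitive _ 'I_4 (fun i => nu i 0)
  (fun j => phi (star_col j)) (nu k0 0) (phi (star_col k0))
  (@factorial_mpoly 4 K) nuk0 minimal_syzygy_primitive.
  by move=> j; rewrite rel mulrC.
have a0 : a != 0.
  apply/negP => /eqP a0.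
  have mul (j : 'I_4) : exists c, star_col j = c *: nu.
    by apply: (iffLR (ker _ (syz_star j))); rewrite aE a0 mul0r.
  have [i [j]] := star_nonzero; case/negP; apply/eqP; apply: (mulfI nuk0).
  rewrite mulr0 coordsE (star_wedge fnu gnu) //.
  have [c cE] := mul k0.
  have NE (i' : 'I_4) : N i' k0 = c * nu i' 0.
    by have := congr1 (fun M : 'cV_4 => M i' 0) cE; rewrite !mxE.
  rewrite !NE -!coordsE; ring.
have ha : a \is a GRing.unit.
  have h := deg _ _ (H0_T_star k0); rewrite aE in h.
  have eE : d%:Z + n%:Z - d%:Z = n%:Z by lia.
  rewrite eE /= in h.
  have [|k [l [nE hk hl]]] := homog_divisor _ h; first by rewrite mulf_neq0.
  have lE := dhomog_uniq nuk0 hl (hnu k0).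
  have k_0 : k = 0%N by lia.
  by rewrite k_0 in hk; apply: homog0_unit hk.
move=> k; exists (a^-1 *: star_col k).
  by rewrite /syz -scalemxAr syz_star scaler0.
by rewrite phiZ ?aE ?mulKr //; apply: syz_star.
Qed.
End Minimal.
End Sequence.

(** * Bounds on the Bourbaki degree *)

Section Bound.
Variables (K : closedFieldType) (char0 : [pchar K] =i pred0).
Variables (s : sequence K) (normal_s : normal_seq s).
Local Notation R := {mpoly K[4]}.

Lemma bourbaki_ideal_is_ideal e (nu : 'cV[R]_4) phi : bourbaki_seq s e nu phi ->
  is_ideal (bourbaki_ideal s phi).
Proof.
move=> [lin _ ker]; have syz0 : syz s 0 by apply: mulmx0.
have phi0 : phi 0 = 0 by apply: (iffRL (ker 0 syz0)); exists 0; rewrite scale0r.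
split; first by exists 0.
  move=> _ _ [u hu <-] [v hv <-]; exists (1 *: u + v); first exact: syz_lin.
  by rewrite lin // mul1r.
move=> a _ [u hu <-]; exists (a *: u + 0); first exact: syz_lin.
by rewrite lin // phi0 addr0.
Qed.

Lemma natr_unit n : (0 < n)%N -> (n%:R : R) \is a GRing.unit.
Proof.
move=> n0; rewrite -[n%:R](rmorph_nat (@mpolyC 4 K)); apply: rmorph_unit.
by rewrite unitfE (iffLR (pcharf0P K) char0) -lt0n.
Qed.

(** For [q] take a nonzero entry of [nu], and for [p] an integral combination of the
entries that avoids the finitely many primes of [q]. *)
Lemma coprime_pair n (nu : 'cV[R]_4) (I : R -> Prop) :
  indeg s = n%:Z -> H0_T s n%:Z nu -> nu != 0 -> is_ideal I ->
  (forall k : 'I_4, I (nu k 0)) ->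
  exists p q : R, [/\ I p, I q, p \is n.-homog, q \is n.-homog & q != 0 /\
     forall a b, a * p = b * q -> divides q a].
Proof.
move=> nE nuT nu0 [I0 ID IM] Inu; have [k nuk] := syzygy_entry_nonzero nu0.
have [u [ps [uu pps qE]]] := @factorial_mpoly 4 K _ nuk.
have [lam hlam] := avoid_primes natr_unit
  (minimal_syzygy_primitive normal_s nE nuT nu0) pps.
have [_ hnu] := nuT.
exists (\sum_i (lam i)%:R * nu i 0), (nu k 0); split.
- by elim/big_ind: _ => // i _; apply: IM; apply: Inu.
- exact: Inu.
- apply: rpred_sum => i _; rewrite mulr_natl; apply: rpredMn; exact: hnu.
- exact: hnu.
by split=> //; rewrite qE; apply: coprime_of_primes.
Qed.

(** The degree of B exists for the Bourbaki map built above; the bounds are then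
needed for the pair, possibly another one, that comes with the chosen degree. *)
Lemma bour_bounds n : indeg s = n%:Z -> 0 <= bour s <= (n ^ 2)%:Z.
Proof.
move=> nE; have [[nu nuT nu0] _] := indeg_spec normal_s; rewrite nE in nuT.
have : is_bour s (bour s).
  apply: epsilon_spec; have bs := bourbaki_map_seq normal_s nE nuT nu0.
  have idI := bourbaki_ideal_is_ideal bs.
  have [p [q [Ip Iq hp hq [q0 cop]]]] := coprime_pair nE nuT nu0 idI
    (syzygy_entries_in_bourbaki_ideal normal_s nE nuT nu0 bs).
  have [b hb] := curve_degree_exists idI Ip Iq hp hq q0 cop.
  by exists b, nu, (bourbaki_map s nu); rewrite nE; split.
move=> {nuT nu0 nu} [nu [phi []]]; rewrite nE => nuT nu0 bs.
have idI := bourbaki_ideal_is_ideal bs.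
have [p [q [Ip Iq hp hq [q0 cop]]]] := coprime_pair nE nuT nu0 idI
  (syzygy_entries_in_bourbaki_ideal normal_s nE nuT nu0 bs).
exact: curve_degree_bounds idI Ip Iq hp hq q0 cop _.
Qed.
End Bound.

Theorem theoremB (K : closedFieldType) (char0 : [pchar K] =i pred0)
    (s : sequence K) (normal_s : normal_seq s) :
  (indeg s = 1 -> bour s = 0 \/ bour s = 1 \/ bour s = 2) /\
  (indeg s = 2 -> bour s <= 5).
Proof.
split=> e; have := bour_bounds char0 normal_s (n := _) e; rewrite ?exp1n; lia.
Qed.
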